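(* Suppose that Assumptions A, B, C-2 and C-3 (stated in the context) hold. Let $\{(x^r,y^r)\}$ be a sequence generated by the HiBSA algorithm with $U_y(u;x,y)=f(x,u)-\frac{1}{2\rho}\|u-y\|^2$ and parameter sequences $\{\gamma^r\},\{\beta^r\}$ as in Assumption C-3. For a given $\epsilon>0$ let $$T(\epsilon):=\min\{r \mid \|\nabla\mathcal{G}^{\beta^{r+1}}_{\rho}(x^{r+1},y^{r+1})\|\le\epsilon,\ r\ge 1\}.$$ Then $T(\epsilon)=\widetilde{\mathcal{O}}\left(\frac{1}{\epsilon^4}\right)$, where $\widetilde{\mathcal{O}}$ denotes $\mathcal{O}$ up to logarithmic factors.
   Context: Problem. $\min_x\max_y \ell(x,y):=f(x_1,\dots,x_K,y)+\sum_{i=1}^K h_i(x_i)-g(y)$ subject to $x_i\in\mathcal{X}_i$ ($i=1,\dots,K$), $y\in\mathcal{Y}$, with $x=[x_1;\dots;x_K]\in\mathbb{R}^{NK}$, $x_i\in\mathbb{R}^N$, $y\in\mathbb{R}^M$, $\mathcal{X}=\mathcal{X}_1\times\dots\times\mathcal{X}_K$. $\|\cdot\|$ is the Euclidean norm; $x_{-i}$ denotes $x$ with block $i$ removed. Assumption A. (A.1) $f:\mathbb{R}^{KN+M}\to\mathbb{R}$ is continuously differentiable; $\mathcal{X}_i$ and $\mathcal{Y}$ are convex and compact; $\ell(x,y)\ge\underline{\ell}$ for all $x\in\mathcal{X},y\in\mathcal{Y}$. (A.2) $h_i:\mathbb{R}^N\to\mathbb{R}$ and $g:\mathbb{R}^M\to\mathbb{R}$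 are convex (possibly non-smooth). (A.3) For all $z,\bar z\in\mathcal{X}\times\mathcal{Y}$: $\|\nabla_{x_i}f(\bar z)-\nabla_{x_i}f(z)\|\le L_{x_i}\|\bar z-z\|$ for every $i$, and $\|\nabla_y f(\bar z)-\nabla_y f(z)\|\le L_y\|\bar z-z\|$. Assumption B (approximation functions $U_i(\cdot;w,y):\mathbb{R}^N\to\mathbb{R}$). (B.1) Each $U_i(\cdot;w,y)$ is strongly convex with modulus $\mu_i>0$: $U_i(x_i;w,y)-U_i(z_i;w,y)\ge\langle\nabla_{z_i}U_i(z_i;w,y),x_i-z_i\rangle+\frac{\mu_i}{2}\|x_i-z_i\|^2$ for all $w\in\mathcal{X},y\in\mathcal{Y},x_i,z_i\in\mathcal{X}_i$. (B.2) $\nabla_{z_i}U_i(z_i;x,y)|_{z_i=x_i}=\nabla_{x_i}f(x,y)$ for all $i$, $x\in\mathcal{X},y\in\mathcal{Y}$. (B.3) $U_i(z_i;x,y)\ge f(z_i,x_{-i},y)$ and $U_i(x_i;x,y)=f(x,y)$ for all $x\in\mathcal{X},y\in\mathcal{Y},z_i\in\mathcal{X}_i$. (B.4) $\|\nabla U_i(z_i;w,y)-\nabla U_i(v_i;w,y)\|\le L_{u_i}\|v_i-z_i\|$ (gradient in the first argument) for all $w\in\mathcal{X},y\in\mathcal{Y},v_i,z_i\in\mathcal{X}_i$. Put $\mu:=\min_i\mu_i$. Assumption C-2. For all $x\in\mathcal{X}$ and $y,z\in\mathcal{Y}$: $f(x,y)-f(x,z)\le\langle\nabla_y f(x,z),y-z\rangle$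 (concavity in $y$); and $U_y(u;x,y)=f(x,u)-\frac{1}{2\rho}\|u-y\|^2$ with a fixed $\rho>0$. Assumption C-3. (1) $\{\gamma^r\}$ is a positive sequence with $\gamma^r-\gamma^{r+1}\ge0$, $\gamma^r\to0$, $\sum_{r=1}^\infty(\gamma^r)^2=\infty$, and $\frac{1}{\gamma^{r+1}}-\frac{1}{\gamma^r}\le\frac{\rho}{5}$ for all $r$. (2) For all $r$: $\beta^r>\rho L_y^2+\frac{4L_y^2}{\rho(\gamma^r)^2}-2\mu$ and $\beta^r>L_{x_i}$ for all $i$. (For example, the condition on $\{\gamma^r\}$ is satisfied by $\gamma^r=\frac{1}{\rho r^{1/4}}$.) HiBSA algorithm. From a starting point $(x^1,y^1)\in\mathcal{X}\times\mathcal{Y}$, at each iteration $r=1,2,\dots$: for $i=1,\dots,K$ in order, with $w_i^{r+1}:=[x_1^{r+1};\dots;x_{i-1}^{r+1};x_i^r;\dots;x_K^r]$, $$x_i^{r+1}=\arg\min_{x_i\in\mathcal{X}_i}U_i(x_i;w_i^{r+1},y^r)+h_i(x_i)+\frac{\beta^r}{2}\|x_i-x_i^r\|^2;$$ then $y^{r+1}=\arg\max_{y\in\mathcal{Y}}U_y(y;x^{r+1},y^r)-g(y)-\frac{\gamma^r}{2}\|y\|^2$. Stationarity gap. $\mathrm{Px}_i^{\beta}(v_i):=\arg\min_{x_i\in\mathcal{X}_i}h_i(x_i)+\frac{\beta}{2}\|x_i-v_i\|^2$, $\mathrm{Py}^{1/\rho}(w):=\arg\max_{y\in\mathcal{Y}}-g(y)-\frac{1}{2\rho}\|y-w\|^2$.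 $\nabla\mathcal{G}^{\beta}_{\rho}(x,y)$ (a symbol, not a gradient) is the stacked vector with blocks $\beta\big(x_i-\mathrm{Px}_i^{\beta}(x_i-\frac1\beta\nabla_{x_i}f(x,y))\big)$, $i=1,\dots,K$, and last block $\frac1\rho\big(y-\mathrm{Py}^{1/\rho}(y+\rho\nabla_y f(x,y))\big)$.
   Formalization: The formal theorem additionally assumes that γ^r is of exact order r^{-1/4} and that β^r = O(1/(γ^r)^2); under Assumption C-3 alone the claimed rate fails (β^r may grow too fast, γ^r may decay too slowly or too fast). *)

(* Defs.v *)
From HB Require Import structures.
From mathcomp Require Import all_boot all_order all_algebra.
From mathcomp Require Import all_classical all_reals all_analysis.

Set Implicit Arguments.
Unset Strict Implicit.
Unset Printing Implicit Defensive.

Import Order.TTheory GRing.Theory Num.Theory.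
Import numFieldNormedType.Exports.

Local Open Scope classical_set_scope.
Local Open Scope ring_scope.

(* The library norm of a matrix is the sup norm and that of a pair is the max
   norm; the Euclidean norms below are the ones meant throughout. Topology,
   differentiability and compactness are those of the library, which do not
   depend on the choice of norm. *)
Section euclidean.
Context {R : realType}.

Definition dot m n (u v : 'M[R]_(m, n)) : R :=
  \sum_(i < m) \sum_(j < n) u i j * v i j.

Definition enorm m n (u : 'M[R]_(m, n)) : R := Num.sqrt (dot u u).

Definition enorm_pair m n p q (z : 'M[R]_(m, n) * 'M[R]_(p, q)) : R :=
  Num.sqrt (enorm z.1 ^+ 2 + enorm z.2 ^+ 2).

Definition grad m n (F : 'M[R]_(m, n) -> R) (z : 'M[R]_(m, n)) : 'M[R]_(m, n) :=
  \matrix_(i < m, j < n) 'D_(delta_mx i j) F z.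

Definition minimizers (T : Type) (A : set T) (F : T -> R) : set T :=
  [set a | A a /\ forall b, A b -> F a <= F b].

Definition maximizers (T : Type) (A : set T) (F : T -> R) : set T :=
  [set a | A a /\ forall b, A b -> F b <= F a].

(* [xget 0 P] is an element of P when P is inhabited (and 0 otherwise). *)
Definition argmin m n (A : set 'M[R]_(m, n)) (F : 'M[R]_(m, n) -> R) :=
  xget 0 (minimizers A F).

Definition argmax m n (A : set 'M[R]_(m, n)) (F : 'M[R]_(m, n) -> R) :=
  xget 0 (maximizers A F).

Definition soft_bigO (F : filter_on R) (f g : R -> R) : Prop :=
  exists k : nat, f =O_F (fun e => g e * `|ln (g e)| ^+ k).

Definition first_hit (a : nat -> R) (eps : R) (t : nat) : Prop :=
  [/\ (1 <= t)%N, a t <= eps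
    & forall r, (1 <= r)%N -> a r <= eps -> (t <= r)%N].

End euclidean.

(* There are K.+1 >= 1 blocks, and x = [x_1; ...; x_(K+1)] is stored as the
   matrix whose i-th row is the block x_i. *)
Section minmax.
Context {R : realType} {K N M : nat}.

Local Notation xvec := 'M[R]_(K.+1, N).
Local Notation block := 'rV[R]_N.
Local Notation yvec := 'rV[R]_M.
Local Notation index := 'I_K.+1.

Implicit Types (f : xvec * yvec -> R) (h : index -> block -> R) (g : yvec -> R).
Implicit Types (X : index -> set block) (Y : set yvec).
Implicit Types (U : index -> block -> xvec -> yvec -> R).
Implicit Types (x w : xvec) (y : yvec) (Lx Lu mu : index -> R).
Implicit Types (beta gamma : nat -> R).

Definition block_prod X : set xvec := [set x | forall i, X i (row i x)].

(* (z, x_{-i}): x with its i-th block replaced by z. *)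
Definition set_block x (i : index) (z : block) : xvec :=
  \matrix_(k < K.+1) (if k == i then z else row k x).

Definition ell f h g x y : R := f (x, y) + \sum_(i < K.+1) h i (row i x) - g y.

(* The gradient in the i-th block is row i of [gradx]. *)
Definition gradx f x y : xvec := grad (fun x' => f (x', y)) x.
Definition grady f x y : yvec := grad (fun y' => f (x, y')) y.

Definition min_modulus mu : R := \big[Num.min/mu ord0]_(i < K.+1) mu i.

Record assumptionA f h g X Y (l_low : R) Lx (Ly : R) : Prop := {
  A1_differentiable : forall z, differentiable f z ;
  A1_continuous_gradx : continuous (fun z : xvec * yvec => gradx f z.1 z.2) ;
  A1_continuous_grady : continuous (fun z : xvec * yvec => grady f z.1 z.2) ;
  A1_convex_X : forall i, convex_set (X i) ;
  A1_compact_X : forall i, compact (X i) ;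
  A1_convex_Y : convex_set Y ;
  A1_compact_Y : compact Y ;
  A1_lower_bound : forall x y, block_prod X x -> Y y -> l_low <= ell f h g x y ;
  A2_convex_h : forall i, convex_function setT (h i) ;
  A2_convex_g : convex_function setT g ;
  A3_lipschitz_x : forall i x x' y y',
    block_prod X x -> Y y -> block_prod X x' -> Y y' ->
    enorm (row i (gradx f x' y') - row i (gradx f x y))
      <= Lx i * enorm_pair (x' - x, y' - y) ;
  A3_lipschitz_y : forall x x' y y',
    block_prod X x -> Y y -> block_prod X x' -> Y y' ->
    enorm (grady f x' y' - grady f x y) <= Ly * enorm_pair (x' - x, y' - y)
}.

Record assumptionB f X Y U mu Lu : Prop := {
  (* implicit in the use of the gradients of the U_i below *)
  B_differentiable : forall i w y z, block_prod X w -> Y y -> X i z ->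
    differentiable (fun u => U i u w y) z ;
  B1_modulus_gt0 : forall i, 0 < mu i ;
  B1_strongly_convex : forall i w y u z,
    block_prod X w -> Y y -> X i u -> X i z ->
    dot (grad (fun u' => U i u' w y) z) (u - z)
      + mu i / 2 * enorm (u - z) ^+ 2 <= U i u w y - U i z w y ;
  B2_gradient_match : forall i x y, block_prod X x -> Y y ->
    grad (fun u => U i u x y) (row i x) = row i (gradx f x y) ;
  B3_upper_bound : forall i x y z, block_prod X x -> Y y -> X i z ->
    f (set_block x i z, y) <= U i z x y ;
  B3_tight : forall i x y, block_prod X x -> Y y ->
    U i (row i x) x y = f (x, y) ;
  B4_lipschitz : forall i w y v z,
    block_prod X w -> Y y -> X i v -> X i z ->
    enorm (grad (fun u => U i u w y) z - grad (fun u => U i u w y) v)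
      <= Lu i * enorm (v - z)
}.

Definition assumptionC2 f X Y : Prop :=
  forall x y z, block_prod X x -> Y y -> Y z ->
    f (x, y) - f (x, z) <= dot (grady f x z) (y - z).

Definition Uy f (rho : R) (u : yvec) x y : R :=
  f (x, u) - (2 * rho)^-1 * enorm (u - y) ^+ 2.

Record assumptionC3 (rho : R) mu Lx (Ly : R) gamma beta : Prop := {
  C3_gamma_gt0 : forall r, (1 <= r)%N -> 0 < gamma r ;
  C3_gamma_decr : forall r, (1 <= r)%N -> 0 <= gamma r - gamma r.+1 ;
  C3_gamma_cvg0 : gamma @ \oo --> (0 : R) ;
  C3_gamma_sum : (\sum_(1 <= r <oo) (gamma r ^+ 2)%:E = +oo)%E ;
  C3_gamma_slow : forall r, (1 <= r)%N ->
    (gamma r.+1)^-1 - (gamma r)^-1 <= rho / 5 ;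
  C3_beta_descent : forall r, (1 <= r)%N ->
    rho * Ly ^+ 2 + 4 * Ly ^+ 2 / (rho * gamma r ^+ 2) - 2 * min_modulus mu
      < beta r ;
  C3_beta_lipschitz : forall r i, (1 <= r)%N -> Lx i < beta r
}.

(* w_i^{r+1} = [x_1^{r+1}; ...; x_{i-1}^{r+1}; x_i^r; ...; x_K^r] *)
Definition partial_update (xnew xold : xvec) (i : index) : xvec :=
  \matrix_(k < K.+1) (if (k < i)%N then row k xnew else row k xold).

(* Iterations are numbered from 1; the values at index 0 are irrelevant. *)
Record HiBSA f h g X Y U (rho : R) gamma beta
    (x : nat -> xvec) (y : nat -> yvec) : Prop := {
  HiBSA_x1 : block_prod X (x 1%N) ;
  HiBSA_y1 : Y (y 1%N) ;
  HiBSA_x : forall r, (1 <= r)%N -> forall i,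
    minimizers (X i)
      (fun u => U i u (partial_update (x r.+1) (x r) i) (y r) + h i u
                + beta r / 2 * enorm (u - row i (x r)) ^+ 2)
      (row i (x r.+1)) ;
  HiBSA_y : forall r, (1 <= r)%N ->
    maximizers Y
      (fun u => Uy f rho u (x r.+1) (y r) - g u
                - gamma r / 2 * enorm u ^+ 2)
      (y r.+1)
}.

Definition Px h X (i : index) (b : R) (v : block) : block :=
  argmin (X i) (fun u => h i u + b / 2 * enorm (u - v) ^+ 2).

Definition Py g Y (rho : R) (w : yvec) : yvec :=
  argmax Y (fun u => - g u - (2 * rho)^-1 * enorm (u - w) ^+ 2).

Definition stationarity_gap f h g X Y (b rho : R) x y : xvec * yvec :=
  (\matrix_(i < K.+1)
     (b *: (row i x - Px h X i b (row i x - b^-1 *: row i (gradx f x y)))),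
   rho^-1 *: (y - Py g Y rho (y + rho *: grady f x y))).

End minmax.

(* Main.v *)
Require Import Defs.
From HB Require Import structures.
From mathcomp Require Import all_boot all_order all_algebra.
From mathcomp Require Import all_classical all_reals all_analysis.
From mathcomp Require Import ring lra.
Import Order.TTheory GRing.Theory Num.Theory.
Import numFieldNormedType.Exports.
Local Open Scope classical_set_scope.
Local Open Scope ring_scope.

Set Implicit Arguments.
Unset Strict Implicit.
Unset Printing Implicit Defensive.

(** The rate comes from a potential that decreases along the iterates. Write
    [X] for the squared primal step and [d] for the squared dual step of an
    iteration.

    Each primal pass lowers the objective by at least
    [(beta r + mu / 2) * X]: the surrogates are strongly convex, tight at the
    current point and above the objective (lemmas [block_descent] and
    [sweep_descent]). The dual step raises the objective, but the optimality
    conditions of two consecutive dual steps and the concavity in [y] show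
    that the dual velocities contract, thanks to the regularization
    [gamma r]. Adding [d] with weight [2 / (rho ^ 2 * gamma r)] to the
    objective gives a potential that loses
    [primal_decrease r * X + d / (20 * rho)] per iteration (lemmas
    [proximal_ascent_step] and [potential_descent]). The errors due to the
    decrease of [gamma] telescope, because
    [(gamma r / gamma r.+1 - 1) ^ 2 = O(gamma r - gamma r.+1)]; so the
    decreases are summable, and the rate holds with the exponent of the
    logarithm equal to 0.

    The stationarity gap compares the iterates with proximal points. Both
    satisfy variational inequalities which differ by a perturbation of the
    gradient, and monotonicity of the subdifferential bounds their distance
    ([var_ineq_stable]). Hence the squared gap is at most
    [O(beta r) * (sum of two consecutive decreases) + O(gamma r ^ 2)]
    ([gap_sqr_le]). With [gamma r] of order [r ^ (- 1 / 4)] and [beta r] of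
    order at most [r ^ (1 / 2)], some index between [n] and [2 * n] has a
    squared gap [O(n ^ (- 1 / 2))] ([small_gap_in_window]), and this is at
    most [eps ^ 2] once [n] is of order [eps ^ (- 4)] ([first_hit_rate]).

    Two points need separate care. The proximal points are defined by a
    choice among minimizers, so minimizers must exist: this follows from
    compactness and from the continuity of finite convex functions
    ([convex_continuous]). And the Lipschitz constants, hence the [beta r],
    may be negative when the feasible set is a single point; the gap is then
    0 ([lipschitz_ge0_or_single], [gap_single]).

    All estimates are written for squared norms [dot u u], and Young's
    inequality [dot_young] is used where one would expect Cauchy-Schwarz. *)

(** * Squared Euclidean norms *)

Section inner_product.
Context {R : realType} {m n : nat}.
Implicit Types u v w : 'M[R]_(m, n).

Lemma dotC u v : dot u v = dot v u.
Proof. by apply: eq_bigr => i _; apply: eq_bigr => j _; rewrite mulrC. Qed.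

Lemma dotDl u v w : dot (u + v) w = dot u w + dot v w.
Proof.
rewrite /dot -big_split; apply: eq_bigr => i _.
by rewrite -big_split; apply: eq_bigr => j _; rewrite mxE mulrDl.
Qed.

Lemma dotZl a u v : dot (a *: u) v = a * dot u v.
Proof.
rewrite /dot mulr_sumr; apply: eq_bigr => i _.
by rewrite mulr_sumr; apply: eq_bigr => j _; rewrite mxE mulrA.
Qed.

Lemma dotDr u v w : dot w (u + v) = dot w u + dot w v.
Proof. by rewrite dotC dotDl !(dotC w). Qed.

Lemma dotZr a u v : dot v (a *: u) = a * dot v u.
Proof. by rewrite dotC dotZl dotC. Qed.

Lemma dotNl u v : dot (- u) v = - dot u v.
Proof. by rewrite -scaleN1r dotZl mulN1r. Qed.

Lemma dotNr u v : dot v (- u) = - dot v u.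
Proof. by rewrite dotC dotNl dotC. Qed.

Definition dot_linE := (dotDl, dotDr, dotNl, dotNr, dotZl, dotZr).

Lemma dot_ge0 u : 0 <= dot u u.
Proof. by apply: sumr_ge0 => i _; apply: sumr_ge0 => j _; exact: sqr_ge0. Qed.

Lemma enorm_sqr u : enorm u ^+ 2 = dot u u.
Proof. by rewrite sqr_sqrtr ?dot_ge0. Qed.

Lemma dot0 : dot (0 : 'M[R]_(m, n)) 0 = 0.
Proof. by rewrite -(scale0r (0 : 'M[R]_(m, n))) dotZl mul0r. Qed.

Lemma dot_eq0 u : dot u u = 0 -> u = 0.
Proof.
move=> /eqP; rewrite /dot psumr_eq0 => [|i _]; last first.
  by apply: sumr_ge0 => j _; exact: sqr_ge0.
move=> /allP u0; apply/matrixP => i j.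
have := u0 i (mem_index_enum _); rewrite psumr_eq0 => [/allP ui0|k _].
  by have := ui0 j (mem_index_enum _); rewrite mulf_eq0 orbb mxE => /eqP.
exact: sqr_ge0.
Qed.

Lemma dot_young (s : R) u v : 0 < s ->
  dot u v <= s / 2 * dot u u + (2 * s)^-1 * dot v v.
Proof.
move=> s0; have := dot_ge0 (s *: u - v).
rewrite !dot_linE (dotC v u) => h.
have -> : s / 2 * dot u u + (2 * s)^-1 * dot v v =
  (2 * s)^-1 * (s * (s * dot u u) + dot v v) by field; rewrite gt_eqF.
rewrite ler_pdivlMl; last by lra.
by lra.
Qed.

Lemma dot_sqrD u v : dot (u + v) (u + v) <= 2 * dot u u + 2 * dot v v.
Proof. by have := dot_ge0 (u - v); rewrite !dot_linE (dotC v u); lra. Qed.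

End inner_product.

Lemma enorm_pair_sqr (R : realType) m n p q
    (z : 'M[R]_(m, n) * 'M[R]_(p, q)) :
  enorm_pair z ^+ 2 = dot z.1 z.1 + dot z.2 z.2.
Proof.
by rewrite /enorm_pair !enorm_sqr sqr_sqrtr// addr_ge0 ?dot_ge0.
Qed.

Lemma ler_enorm_sqr (R : realType) m n m' n' p q (u : 'M[R]_(m, n)) (L : R)
    (z : 'M[R]_(m', n') * 'M[R]_(p, q)) :
  enorm u <= L * enorm_pair z ->
  dot u u <= L ^+ 2 * (dot z.1 z.1 + dot z.2 z.2).
Proof.
move=> le; have u0 : 0 <= enorm u by exact: sqrtr_ge0.
rewrite -enorm_sqr -enorm_pair_sqr -exprMn ler_pXn2r//.
by rewrite nnegrE (le_trans u0).
Qed.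

(** Splitting [q - c] at an intermediate vector [m] lets the two Lipschitz
    bounds be applied separately. *)
Lemma dot_perturbed_step (R : realType) n (b l L D : R)
    (q m c d e : 'rV[R]_n) :
  b ^+ 2 * dot e e <= dot (q - c) (q - c) ->
  dot (q - m) (q - m) <= l * D -> dot (m - c) (m - c) <= L * D ->
  dot (- (b *: d) + b *: e) (- (b *: d) + b *: e)
    <= 2 * b ^+ 2 * dot d d + 4 * (l + L) * D.
Proof.
move=> he hl hL; apply: le_trans (dot_sqrD _ _) _.
have := dot_sqrD (q - m) (m - c); rewrite addrA subrK.
rewrite dotNl dotNr opprK !dotZl !dotZr !(mulrA b b) -expr2; lra.
Qed.

Lemma dot_rows (R : realType) m n (u v : 'M[R]_(m, n)) :
  dot u v = \sum_(i < m) dot (row i u) (row i v).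
Proof.
apply: eq_bigr => i _; rewrite /dot big_ord1.
by apply: eq_bigr => j _; rewrite !mxE.
Qed.

(** * Convex functions on row vectors *)

Section convexity.
Context {R : realType} {n : nat}.
Implicit Types (u v z : 'rV[R]_n) (A : set 'rV[R]_n) (h : 'rV[R]_n -> R).

Lemma convex_setP A (t : R) u v : convex_set A -> A u -> A v ->
  0 <= t <= 1 -> A (u + t *: (v - u)).
Proof.
move=> cA Au Av /andP[t0 t1].
have := cA v u (Itv01 t0 t1) (mem_set Av) (mem_set Au).
rewrite inE /conv/= /unstable.onem scalerBl scale1r.
by rewrite scalerBr addrC addrAC -addrA.
Qed.

Lemma convex_functionP h (t : R) u v : convex_function setT h ->
  0 <= t <= 1 -> h (u + t *: (v - u)) <= h u + t * (h v - h u).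
Proof.
move=> ch /andP[t0 t1].
have hc : h (t *: v + (1 - t) *: u) <= t * h v + (1 - t) * h u :=
  ch (Itv01 t0 t1) v u (mem_set I) (mem_set I).
have -> : u + t *: (v - u) = t *: v + (1 - t) *: u.
  by rewrite scalerBr scalerBl scale1r addrC addrAC -addrA.
by apply: (le_trans hc); lra.
Qed.

Lemma ler_coord_norm z j : `|z ord0 j| <= `|z|.
Proof.
have /mapP[k Hk ->] : `|z ord0 j| \in [seq `|z x.1 x.2| | x : 'I_1 * 'I_n].
  by apply/mapP; exists (ord0, j) => //=; rewrite mem_enum.
by rewrite [leRHS]/Num.norm /= mx_normrE; apply/bigmax_geP; right => /=; exists k.
Qed.

(** Induction on the number of free coordinates: moving the last free
    coordinate inside [-1, 1] stays between the two translates of the base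
    point by a unit vector. *)
Lemma convex_bounded_above_ball h u : convex_function setT h ->
  exists B, forall z, `|z| <= 1 -> h (u + z) <= B.
Proof.
move=> ch.
suff H k v : exists B, forall z, `|z| <= 1 ->
    (forall j : 'I_n, (k <= j)%N -> z ord0 j = 0) -> h (v + z) <= B.
  have [B HB] := H n u; exists B => z z1; apply: HB => // j.
  by rewrite leqNgt ltn_ord.
elim: k v => [|k IH] v.
  exists (h v) => z _ z0; rewrite (_ : z = 0) ?addr0//.
  by apply/rowP => j; rewrite mxE z0.
have [kn|nk] := ltnP k n; last first.
  have [B HB] := IH v; exists B => z z1 z0; apply: HB => // j kj.
  by have := leq_trans nk kj; rewrite leqNgt ltn_ord.
pose e : 'rV[R]_n := delta_mx ord0 (Ordinal kn).
have [B1 HB1] := IH (v + e); have [B2 HB2] := IH (v - e).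
exists (Num.max B1 B2) => z z1 z0.
pose c := z ord0 (Ordinal kn).
pose z' := z - c *: e.
have z'E j : z' ord0 j = if j == Ordinal kn then 0 else z ord0 j.
  rewrite !mxE eqxx /=; case: eqP => [->|_]; last by rewrite mulr0 subr0.
  by rewrite mulr1 subrr.
have z'1 : `|z'| <= 1.
  rewrite /Num.norm /= mx_normrE; apply/bigmax_leP; split => //= -[i j] _ /=.
  rewrite ord1 z'E; case: ifP => _; first by rewrite normr0.
  exact: (le_trans (ler_coord_norm _ _)).
have z'0 (j : 'I_n) : (k <= j)%N -> z' ord0 j = 0.
  move=> kj; rewrite z'E; case: ifP => // /negbT jk; apply: z0.
  by rewrite ltn_neqAle kj andbT; apply: contra jk => /eqP kE; apply/eqP/val_inj.
have /andP[c1 c2] : -1 <= c <= 1.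
  by rewrite -ler_norml; apply: le_trans z1; exact: ler_coord_norm.
have -> : v + z = (v - e + z') + ((1 + c) / 2) *: ((v + e + z') - (v - e + z')).
  rewrite /z'; apply/rowP => j; rewrite !mxE.
  by field.
apply: le_trans (convex_functionP _ _ ch _) _; first by apply/andP; split; lra.
have h1 : h (v + e + z') <= Num.max B1 B2 by rewrite le_max HB1.
have h2 : h (v - e + z') <= Num.max B1 B2 by rewrite le_max HB2 ?orbT.
set B := Num.max _ _ in h1 h2 *.
have -> : h (v - e + z') + (1 + c) / 2 * (h (v + e + z') - h (v - e + z')) =
  ((1 + c) / 2) * h (v + e + z') + ((1 - c) / 2) * h (v - e + z') by field.
have -> : B = ((1 + c) / 2) * B + ((1 - c) / 2) * B by field.
by apply: lerD; apply: ler_wpM2l => //; lra.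
Qed.

(** A convex function bounded above near [u] is Lipschitz at [u]: compare it
    with the chords from [u] to the points [u + z / |z|] and [u - z / |z|]. *)
Lemma convex_continuous h : convex_function setT h -> continuous h.
Proof.
move=> ch u; have [B HB] := convex_bounded_above_ball u ch.
have Bu : h u <= B by rewrite -[u]addr0 HB ?normr0.
have key z : `|z| <= 1 -> `|h u - h (u + z)| <= `|z| * (B - h u).
  move=> z1; have [->|z0] := eqVneq z 0.
    by rewrite addr0 subrr !normr0 mul0r.
  have tgt0 : 0 < `|z| by rewrite normr_gt0.
  have nz : `| `|z|^-1 *: z | = 1.
    by rewrite normrZ normfV normr_id mulVf ?gt_eqF.
  set t := `|z| in tgt0 nz z1 *; set w := t^-1 *: z in nz.
  have zw : z = t *: w by rewrite /w scalerA mulfV ?scale1r ?gt_eqF.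
  have up : h (u + z) <= h u + t * (h (u + w) - h u).
    have -> : u + z = u + t *: ((u + w) - u) by rewrite addrAC subrr add0r zw.
    by apply: convex_functionP => //; rewrite (ltW tgt0).
  have hw : h (u + w) <= B by rewrite HB ?nz.
  have hw' : h (u - w) <= B by rewrite HB ?normrN ?nz.
  have dn : h u <= h (u + z) + t / (1 + t) * (h (u - w) - h (u + z)).
    have {1}-> : u = u + z + (t / (1 + t)) *: ((u - w) - (u + z)).
      by rewrite zw; apply/rowP => j; rewrite !mxE; field; rewrite gt_eqF; lra.
    apply: convex_functionP => //; apply/andP; split.
      by rewrite divr_ge0; lra.
    by rewrite ler_pdivrMr; lra.
  have {dn}dn : (1 + t) * h u <= h (u + z) + t * h (u - w).
    have t1 : 0 < 1 + t by lra.
    rewrite -ler_pdivlMl//; apply: le_trans dn _; rewrite le_eqVlt; apply/orP; left.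
    by apply/eqP; field; rewrite gt_eqF.
  have m1 : t * h (u + w) <= t * B by rewrite ler_pM2l.
  have m2 : t * h (u - w) <= t * B by rewrite ler_pM2l.
  by rewrite ler_norml; apply/andP; split; lra.
apply/(@cvgrPdist_lt _ R^o _ (nbhs u) (nbhs_filter u)) => e e0; apply/nbhs_ballP.
have B1 : 0 < B - h u + 1 by lra.
exists (Num.min 1 (e / (B - h u + 1))) => /=.
  by rewrite lt_min ltr01 divr_gt0.
move=> v; rewrite -ball_normE /= lt_min -normrN opprB => /andP[v1 ve].
have := key (v - u) (ltW v1); rewrite (addrC u) subrK => /le_lt_trans; apply.
move: ve; rewrite ltr_pdivlMr// mulrDr mulr1; apply: le_lt_trans.
by rewrite lerDl.
Qed.

End convexity.

(** * Optimality conditions and proximal operators *)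

Section variational.
Context {R : realType} {n : nat}.
Implicit Types (u v p q d : 'rV[R]_n) (A : set 'rV[R]_n).
Implicit Types (h phi : 'rV[R]_n -> R).

Lemma derive_dot_grad phi p d : differentiable phi p ->
  'D_d phi p = dot (grad phi p) d.
Proof.
move=> dphi; rewrite deriveE// {1}[d]matrix_sum_delta linear_sum /dot.
apply: eq_bigr => i _; rewrite linear_sum; apply: eq_bigr => j _.
by rewrite linearZ /= mxE deriveE// mulrC.
Qed.

(** [- q] is a subgradient at [p] of [h] plus the indicator of [A]. *)
Definition var_ineq A h q p : Prop :=
  A p /\ forall u, A u -> 0 <= dot q (u - p) + (h u - h p).

(** Along the segment from a minimizer [p] to [u], the convex part lies below
    its chord and the quadratic part is [t] times a linear form plus
    [O(t ^ 2)]; dividing by [t] and letting [t] tend to 0 leaves the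
    derivative of [phi]. *)
Lemma minimizer_var_ineq A phi h (b : R) v p :
  convex_set A -> convex_function setT h -> differentiable phi p ->
  minimizers A (fun u => phi u + h u + b / 2 * enorm (u - v) ^+ 2) p ->
  var_ineq A h (grad phi p + b *: (p - v)) p.
Proof.
move=> cA ch dphi [Ap pmin]; split => // u Au.
move dE : (u - p) => d.
rewrite dotDl -derive_dot_grad// dotZl.
pose quot t : R := t^-1 * (phi (t *: d + p) - phi p).
have cvq : quot t @[t --> 0^'+] --> ('D_d phi p : R).
  by apply: cvg_dnbhs_at_right; exact: (diff_derivable dphi).
pose G t : R := quot t + (b * dot (p - v) d + (h u - h p) + t * (b / 2 * dot d d)).
have cvG : G t @[t --> 0^'+] -->
    'D_d phi p + (b * dot (p - v) d + (h u - h p) + 0 * (b / 2 * dot d d)).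
  apply: cvgD => //; apply: cvgD; first exact: cvg_cst.
  apply: cvgM; last exact: cvg_cst.
  by apply: cvg_at_right_filter; exact: cvg_id.
rewrite -addrA -[X in _ + X]addr0 -[X in _ + (_ + X)](mul0r (b / 2 * dot d d)).
rewrite -(cvg_lim _ cvG)//; apply: limr_ge; first by apply: cvgP cvG.
have lt1 : \forall t \near (0:R)^'+, t < 1 by apply: nbhs_right_lt.
have gt0 : \forall t \near (0:R)^'+, 0 < t by apply: nbhs_right_gt.
near=> t.
have t0 : 0 < t by near: t.
have t1 : t < 1 by near: t.
have t01 : 0 <= t <= 1 by rewrite !ltW.
have := pmin _ (convex_setP cA Ap Au t01).
have := convex_functionP p u ch t01.
rewrite dE !enorm_sqr (_ : p + t *: d - v = (p - v) + t *: d); last first.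
  by rewrite addrAC.
rewrite !dot_linE (dotC d p) (dotC d v) [p + _]addrC => hh mm.
rewrite /G /quot !dot_linE -(pmulr_rge0 _ t0) mulrDr mulVKf ?gt_eqF//.
move: hh mm; lra.
Unshelve. all: by end_near. Qed.

Lemma continuous_dot v : continuous (fun u : 'rV[R]_n => dot (u - v) (u - v)).
Proof.
rewrite /dot; apply: (@continuous_big R _ +%R).
  by move=> z; exact: (@add_continuous _ z).
move=> i _; apply: (@continuous_big R _ +%R).
  by move=> z; exact: (@add_continuous _ z).
move=> j _ u; have cj : {for u, continuous (fun u : 'rV[R]_n => (u - v) i j)}.
  rewrite (_ : (fun _ => _) = (fun u : 'rV[R]_n => u i j - v i j)).
    by apply: continuousB; [exact: (@coord_continuous R 1 n i j u)|exact: cst_continuous].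
  by apply/funext => w; rewrite !mxE.
exact: (cvgM cj cj).
Qed.

Lemma compact_bounded_dot A : compact A ->
  exists B, forall u, A u -> dot u u <= B.
Proof.
move=> cA; have [[a Aa]|A0] := pselect (A !=set0); last first.
  by exists 0 => u Au; case: A0; exists u.
have ct : {within A, continuous (fun u : 'rV[R]_n => dot (u - 0) (u - 0))}.
  exact/continuous_subspaceT/continuous_dot.
have [c _ cmax] := compact_EVT_max (ex_intro _ a Aa) cA ct.
exists (dot c c) => u Au; have := cmax u (mem_set Au); by rewrite !subr0.
Qed.

Lemma prox_exists A h (b : R) v :
  A !=set0 -> compact A -> convex_function setT h ->
  exists p, minimizers A (fun u => h u + b / 2 * enorm (u - v) ^+ 2) p.
Proof.
move=> A0 cA ch.
have cf : continuous (fun u => h u + b / 2 * dot (u - v) (u - v)).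
  move=> u; apply: (@continuousD R R^o _ h); first exact: (convex_continuous ch).
  by apply: continuousM; [exact: cst_continuous|exact: continuous_dot].
have [c cA' cmin] := compact_EVT_min A0 cA (continuous_subspaceT cf).
exists c; split => [|t At]; first by rewrite inE in cA'.
by rewrite !enorm_sqr; exact/cmin/mem_set.
Qed.

Lemma grad_cst0 p : grad (fun=> 0 : R) p = 0 :> 'rV[R]_n.
Proof. by apply/matrixP => i j; rewrite !mxE derive_cst. Qed.

Lemma prox_var_ineq A h (b : R) v p :
  convex_set A -> convex_function setT h ->
  minimizers A (fun u => h u + b / 2 * enorm (u - v) ^+ 2) p ->
  var_ineq A h (b *: (p - v)) p.
Proof.
move=> cA ch pm.
rewrite -[b *: _]add0r -(grad_cst0 p); apply: minimizer_var_ineq => //.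
by have [Ap pmin] := pm; split => // u Au; rewrite !add0r; exact: pmin.
Qed.

(** Completing the square merges the two quadratic penalties into one, which
    reduces the claim to [minimizer_var_ineq]. *)
Lemma ascent_var_ineq A (phi h : 'rV[R]_n -> R) (rho c : R) w p :
  0 < rho -> 0 < c ->
  convex_set A -> convex_function setT h -> differentiable phi p ->
  maximizers A (fun u => phi u - (2 * rho)^-1 * enorm (u - w) ^+ 2 - h u
                         - c / 2 * enorm u ^+ 2) p ->
  var_ineq A h (- grad phi p + rho^-1 *: (p - w) + c *: p) p.
Proof.
move=> r0 c0 cA ch dphi [Ap pmax].
pose s := rho^-1 + c.
have ri : 0 < rho^-1 by rewrite invr_gt0.
have s0 : 0 < s by rewrite /s; lra.
have gN : - grad phi p = grad (fun u => - phi u) p.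
  apply/matrixP => i j; rewrite !mxE.
  by rewrite -deriveN//; exact: diff_derivable.
have -> : - grad phi p + rho^-1 *: (p - w) + c *: p =
    grad (fun u => - phi u) p + s *: (p - (rho * s)^-1 *: w).
  rewrite -gN -addrA; congr (_ + _); apply/matrixP => i j; rewrite !mxE /s.
  by field; rewrite !gt_eqF//; nra.
apply: minimizer_var_ineq => //; first exact: differentiableN.
split => // u Au; have := pmax u Au.
have sq (z : 'rV[R]_n) : s / 2 * enorm (z - (rho * s)^-1 *: w) ^+ 2 =
    (2 * rho)^-1 * enorm (z - w) ^+ 2 + c / 2 * enorm z ^+ 2 +
    (rho^-1 ^+ 2 / (2 * s) - rho^-1 / 2) * dot w w.
  rewrite !enorm_sqr !dot_linE (dotC w z).
  by rewrite /s; field; rewrite !gt_eqF//; nra.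
by rewrite !sq; lra.
Qed.

(** The subdifferential is monotone. Young's inequality then turns the
    inner product of the two perturbations into squared norms. *)
Lemma var_ineq_stable A h (b : R) a a' v p p' : 0 < b ->
  var_ineq A h (a + b *: (p - v)) p -> var_ineq A h (a' + b *: (p' - v)) p' ->
  b ^+ 2 * dot (p - p') (p - p') <= dot (a - a') (a - a').
Proof.
move=> b0 [Ap vp] [Ap' vp'].
have h1 := vp _ Ap'; have h2 := vp' _ Ap.
have bi : 0 < b^-1 by rewrite invr_gt0.
have yg := dot_young (a' - a) (p - p') bi.
have mono : b * dot (p - p') (p - p') <= dot (a' - a) (p - p').
  move: h1 h2; rewrite !dot_linE (dotC p' p) (dotC v p) (dotC v p'); lra.
have -> : dot (a - a') (a - a') = dot (a' - a) (a' - a).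
  by rewrite -opprB dotNl dotNr opprK.
have {}yg : dot (a' - a) (p - p') <=
    b^-1 / 2 * dot (a' - a) (a' - a) + b / 2 * dot (p - p') (p - p').
  apply: le_trans yg _; rewrite lerD2l le_eqVlt; apply/orP; left; apply/eqP.
  by field; rewrite gt_eqF.
have : b * dot (p - p') (p - p') <= b^-1 * dot (a' - a) (a' - a).
  by move: mono yg; lra.
by rewrite ler_pdivlMl// expr2 mulrA.
Qed.

End variational.

Section proximal_operators.
Context {R : realType} {K N M : nat}.
Implicit Types (h : 'I_K.+1 -> 'rV[R]_N -> R) (X : 'I_K.+1 -> set 'rV[R]_N).

Lemma Px_var_ineq h X i (b : R) v :
  X i !=set0 -> compact (X i) -> convex_set (X i) ->
  convex_function setT (h i) ->
  var_ineq (X i) (h i) (b *: (Px h X i b v - v)) (Px h X i b v).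
Proof.
move=> X0 cX cvX ch; apply: prox_var_ineq => //.
by apply: xgetPex; exact: prox_exists.
Qed.

Lemma Py_var_ineq (g : 'rV[R]_M -> R) (Y : set 'rV[R]_M) (rho : R) w :
  Y !=set0 -> compact Y -> convex_set Y -> convex_function setT g -> 
  var_ineq Y g (rho^-1 *: (Py g Y rho w - w)) (Py g Y rho w).
Proof.
move=> Y0 cY cvY cg; apply: prox_var_ineq => //.
have E : rho^-1 / 2 = (2 * rho)^-1 by rewrite invfM mulrC.
have mm p : minimizers Y (fun u => g u + rho^-1 / 2 * enorm (u - w) ^+ 2) p <->
   maximizers Y (fun u => - g u - (2 * rho)^-1 * enorm (u - w) ^+ 2) p.
  by rewrite /minimizers /maximizers/= E; split=> -[Yp pm]; split=> // u Yu;
    have := pm u Yu; lra.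
have [p /mm pm] := prox_exists rho^-1 w Y0 cY cg.
by apply/mm; exact: (xgetPex _ (ex_intro _ p pm)).
Qed.

End proximal_operators.

(** * One proximal ascent step *)

Section ascent_potential.
Context {R : realType} {M : nat}.

(** The velocities are [d1 = y1 - y0] and [d2 = y2 - y1]. By monotonicity of
    the gradient in [y], the difference of the two optimality conditions
    gives a recursion on the squared velocities which contracts at rate
    [c']. Multiplied by [4 / (rho * c')], it yields [2 / rho] times [dot d2 d2].
    This pays [3 / (2 * rho)] for the increase of the objective,
    [2 / (5 * rho)] for the growth of the weight [2 / (rho ^ 2 * c)],
    [1 / (20 * rho)] for the change of the regularization, and leaves
    [1 / (20 * rho)].

    The change of the regularization contributes
    [q * (dot y2 y2 - dot y1 y1)] with [q = c / c' - 1]. Young's inequality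
    reduces it to [q ^ 2], and slow variation gives
    [q ^ 2 <= rho / 5 * H * (c - c')], which telescopes. *)
Lemma proximal_ascent_step (g : 'rV[R]_M -> R) (rho c c' L H D X fb fc : R)
    (y0 y1 y2 G1 G2 G3 : 'rV[R]_M) :
  0 < rho -> 0 < c' -> c' <= c -> c'^-1 - c^-1 <= rho / 5 ->
  1 + c * rho / 5 <= H ->
  dot y1 y1 <= D -> dot y2 y2 <= D ->
  0 <= dot (- G1 + rho^-1 *: (y1 - y0) + c *: y1) (y2 - y1) + (g y2 - g y1) ->
  0 <= dot (- G2 + rho^-1 *: (y2 - y1) + c' *: y2) (y1 - y2) + (g y1 - g y2) ->
  fc - fb <= dot G3 (y2 - y1) -> fb - fc <= dot G2 (y1 - y2) ->
  dot (G3 - G1) (G3 - G1) <= L ^+ 2 * X ->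
  (fc - g y2) + (2 / (rho ^+ 2 * c') + 9 / (10 * rho)) * dot (y2 - y1) (y2 - y1)
    - c' / 2 * dot y2 y2 + (16 * H + 2^-1) * D * c'
    + 1 / (20 * rho) * dot (y2 - y1) (y2 - y1)
  <= (fb - g y1) + (2 / (rho ^+ 2 * c) + 9 / (10 * rho)) * dot (y1 - y0) (y1 - y0)
    - c / 2 * dot y1 y1 + (16 * H + 2^-1) * D * c
    + (rho * L ^+ 2 / 2 + 2 * L ^+ 2 / (rho * c' ^+ 2)) * X.
Proof.
move=> r0 c'0 cc' slow Hb D1 D2 vi1 vi2 cv3 cv2 lip.
have c0 : 0 < c by lra.
move d1E : (y1 - y0) => d1; move d2E : (y2 - y1) => d2.
have y2E : y2 = y1 + d2 by rewrite -d2E addrC subrK.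
have d2N : y1 - y2 = - d2 by rewrite -d2E opprB.
rewrite d1E d2E in vi1; rewrite d2E d2N in vi2; rewrite d2N in cv2.
rewrite d2E in cv3.
have sq2 : dot y2 y2 = dot y1 y1 + 2 * dot y1 d2 + dot d2 d2.
  by rewrite y2E !dot_linE (dotC d2 y1); ring.
have y2d : dot y2 d2 = dot y1 d2 + dot d2 d2 by rewrite y2E dotDl.
have e12 : dot d1 d2 <= dot d1 d1 / 2 + dot d2 d2 / 2.
  by have := dot_ge0 (d1 - d2); rewrite !dot_linE (dotC d2 d1); lra.
have dd1 := dot_ge0 d1; have dd2 := dot_ge0 d2.
have yg1 := dot_young (G3 - G1) d2 r0.
have ic'0 : 0 < c'^-1 by rewrite invr_gt0.
have yg2 := dot_young (G3 - G1) d2 ic'0.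
have ri0 : 0 < rho^-1 by rewrite invr_gt0.
rewrite !dot_linE in vi1 vi2 cv2.
have exG : dot (G3 - G1) d2 = dot G3 d2 - dot G1 d2 by rewrite dotDl dotNl.
rewrite exG in yg1 yg2.
set w := dot y1 d2 in sq2 y2d vi1 vi2.
rewrite y2d in vi2.
pose q := c / c' - 1.
have q0 : 0 <= q by rewrite subr_ge0 ler_pdivlMr ?mul1r.
have qE : c = (1 + q) * c' by rewrite /q; field; rewrite gt_eqF.
have qle : q <= c * rho / 5.
  have -> : q = c * (c'^-1 - c^-1) by rewrite /q; field; rewrite !gt_eqF.
  by rewrite -mulrA ler_pM2l.
have q2 : q ^+ 2 <= rho / 5 * H * (c - c').
  have -> : c - c' = q * c' by rewrite qE; ring.
  rewrite expr2 -!mulrA !(mulrCA _ q) ler_wpM2l//.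
  apply: (le_trans qle); rewrite qE.
  have Hq : 1 + q <= H by lra.
  have rc : 0 < rho * c' by rewrite mulr_gt0.
  by nra.
have cross : q * (dot y2 y2 - dot y1 y1) <= 40 * D * q ^+ 2 + dot d2 d2 / 40.
  have -> : q * (dot y2 y2 - dot y1 y1) = dot (q *: (y1 + y2)) d2.
    by rewrite dotZl dotDl y2d sq2 /w; ring.
  (* the weight 20 charges only [dot d2 d2 / 20] to the velocity after scaling
     by [2 / rho] *)
  have t0 : (0 : R) < 20 by lra.
  apply: le_trans (dot_young _ _ t0) _.
  have := dot_sqrD y1 y2; rewrite dotZl dotZr.
  set s := dot (y1 + y2) _ => hs.
  have : q ^+ 2 * s <= q ^+ 2 * (4 * D) by apply: ler_wpM2l; [exact: sqr_ge0|lra].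
  rewrite !expr2; lra.
have q2' : 80 / rho * D * q ^+ 2 <= 16 * H * D * (c - c').
  have D0 : 0 <= D := le_trans (dot_ge0 _) D1.
  have k0 : 0 <= 80 / rho * D by rewrite mulr_ge0// divr_ge0// ltW.
  have -> : 16 * H * D * (c - c') = 80 / rho * D * (rho / 5 * H * (c - c')).
    by field; rewrite gt_eqF.
  exact: ler_wpM2l.
have slow' : 2 / (rho ^+ 2 * c') * dot d1 d1 <=
    2 / (rho ^+ 2 * c) * dot d1 d1 + 4 / (10 * rho) * dot d1 d1.
  rewrite -mulrDl; apply: ler_wpM2r => //.
  have -> : 2 / (rho ^+ 2 * c') = 2 * rho^-1 ^+ 2 * c'^-1 by field; rewrite !gt_eqF.
  have -> : 2 / (rho ^+ 2 * c) + 4 / (10 * rho) =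
    2 * rho^-1 ^+ 2 * (c^-1 + rho / 5) by field; rewrite !gt_eqF.
  by apply: ler_wpM2l; [rewrite mulr_ge0// sqr_ge0|lra].
(* the velocity recursion, scaled by 4 / (rho * c') *)
have vel : 2 / (rho ^+ 2 * c') * dot d2 d2 <= 2 / (rho ^+ 2 * c') * dot d1 d1
    + 2 * L ^+ 2 / (rho * c' ^+ 2) * X - 2 / rho * dot d2 d2
    + 2 / rho * (q * (dot y2 y2 - dot y1 y1)).
  have base : dot d2 d2 / (2 * rho) <= dot d1 d1 / (2 * rho)
      + L ^+ 2 * X / (2 * c') - c' / 2 * dot d2 d2
      + (c - c') / 2 * (dot y2 y2 - dot y1 y1).
    have cd : c' * dot d2 d2 <= c * dot d2 d2 by apply: ler_wpM2r.
    have e12' : rho^-1 * dot d1 d2 <= rho^-1 * (dot d1 d1 / 2 + dot d2 d2 / 2).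
      by apply: ler_wpM2l => //; exact: ltW.
    have lip' : c'^-1 / 2 * dot (G3 - G1) (G3 - G1) <= c'^-1 / 2 * (L ^+ 2 * X).
      by apply: ler_wpM2l => //; lra.
    have E1 : (2 * c'^-1)^-1 = c' / 2 by field; rewrite gt_eqF.
    have E2 : L ^+ 2 * X / (2 * c') = c'^-1 / 2 * (L ^+ 2 * X).
      by field; rewrite gt_eqF.
    have E3 t : t / (2 * rho) = rho^-1 * (t / 2) by field; rewrite gt_eqF.
    rewrite E1 in yg2; rewrite E2 !E3 sq2.
    by lra.
  have k0 : 0 <= 4 / (rho * c') by rewrite divr_ge0// mulr_ge0// ltW.
  have := ler_wpM2l k0 base.
  have -> : 4 / (rho * c') * (dot d2 d2 / (2 * rho)) =
    2 / (rho ^+ 2 * c') * dot d2 d2 by field; rewrite !gt_eqF.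
  move/le_trans; apply; rewrite le_eqVlt; apply/orP; left; apply/eqP.
  by rewrite /q; field; rewrite !gt_eqF.
(* the gain of the ascent step, bounded by the previous optimality condition *)
have gain : (fc - g y2) - (fb - g y1) <= rho * L ^+ 2 / 2 * X
    + dot d2 d2 / rho + dot d1 d1 / (2 * rho)
    + c / 2 * (dot y2 y2 - dot y1 y1).
  have e12' : rho^-1 * dot d1 d2 <= rho^-1 * (dot d1 d1 / 2 + dot d2 d2 / 2).
    by apply: ler_wpM2l => //; exact: ltW.
  have cd : 0 <= c * dot d2 d2 by rewrite mulr_ge0// ltW.
  have lip' : rho / 2 * dot (G3 - G1) (G3 - G1) <= rho / 2 * (L ^+ 2 * X).
    by apply: ler_wpM2l => //; lra.
  have E2 : (2 * rho)^-1 = rho^-1 / 2 by rewrite invfM mulrC.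
  have E4 : dot d1 d1 / (2 * rho) = rho^-1 * (dot d1 d1 / 2).
    by rewrite E2; ring.
  have E5 : dot d2 d2 / rho = rho^-1 * dot d2 d2 by rewrite mulrC.
  rewrite E2 in yg1; rewrite E4 E5 sq2.
  by lra.
have cross' : 2 / rho * (q * (dot y2 y2 - dot y1 y1)) <=
    80 / rho * D * q ^+ 2 + dot d2 d2 / (20 * rho).
  have k0 : 0 <= 2 / rho by rewrite divr_ge0// ltW.
  have := ler_wpM2l k0 cross; move/le_trans; apply.
  by rewrite le_eqVlt; apply/orP; left; apply/eqP; field; rewrite gt_eqF.
have cD : (c - c') * dot y2 y2 <= (c - c') * D.
  by apply: ler_wpM2l => //; lra.
have E6 t : t / rho = rho^-1 * t by rewrite mulrC.
have E7 (k t : R) : t / (k * rho) = rho^-1 * t / k by rewrite invfM; ring.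
rewrite !E7 !E6 in vel gain cross' slow' q2' *.
move: vel gain cross' slow' q2' cD; clear; lra.
Qed.

End ascent_potential.

(** * The iterates: descent, potential and gap *)

Section sweep.
Context {R : realType} {K N : nat}.
Implicit Types (old new : 'M[R]_(K.+1, N)).

(** The state of a Gauss-Seidel pass after [n] blocks; [partial_update] is
    its restriction to block indices, and taking [n : nat] adds the completed
    pass. *)
Definition sweep new old (n : nat) : 'M[R]_(K.+1, N) :=
  \matrix_(k < K.+1) (if (k < n)%N then row k new else row k old).

Lemma row_sweep new old n k :
  row k (sweep new old n) = if (k < n)%N then row k new else row k old.
Proof. by rewrite rowK. Qed.

Lemma sweep0 new old : sweep new old 0 = old.
Proof. by apply/row_matrixP => k; rewrite row_sweep. Qed.

Lemma sweep_full new old : sweep new old K.+1 = new.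
Proof. by apply/row_matrixP => k; rewrite row_sweep ltn_ord. Qed.

Lemma sweepS new old (i : 'I_K.+1) :
  set_block (sweep new old i) i (row i new) = sweep new old i.+1.
Proof.
apply/row_matrixP => k; rewrite rowK !row_sweep ltnS.
case: eqP => [->|ki]; first by rewrite leqnn.
by rewrite [in RHS]leq_eqVlt (negbTE (_ : (k : nat) != i)) //; apply/eqP => /val_inj.
Qed.

Lemma sweep_in (X : 'I_K.+1 -> set 'rV[R]_N) new old n :
  block_prod X new -> block_prod X old -> block_prod X (sweep new old n).
Proof. by move=> Xn Xo i /=; rewrite row_sweep; case: ifP. Qed.

Lemma dot_sweep_le new old n :
  dot (sweep new old n - old) (sweep new old n - old) <= dot (new - old) (new - old).
Proof.
rewrite !dot_rows; apply: ler_sum => i _; rewrite !linearB/= row_sweep.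
by case: ifP => // _; rewrite subrr dot0 dot_ge0.
Qed.

End sweep.

Section iterates.
Context {R : realType} {K N M : nat}.
Context (f : 'M[R]_(K.+1, N) * 'rV[R]_M -> R).
Context (h : 'I_K.+1 -> 'rV[R]_N -> R) (g : 'rV[R]_M -> R).
Context (X : 'I_K.+1 -> set 'rV[R]_N) (Y : set 'rV[R]_M).
Context (U : 'I_K.+1 -> 'rV[R]_N -> 'M[R]_(K.+1, N) -> 'rV[R]_M -> R).
Context (l_low : R) (Lx : 'I_K.+1 -> R) (Ly : R) (mu Lu : 'I_K.+1 -> R).
Context (rho : R) (gamma beta : nat -> R).
Context (x : nat -> 'M[R]_(K.+1, N)) (y : nat -> 'rV[R]_M).
Context (hA : assumptionA f h g X Y l_low Lx Ly).
Context (hB : assumptionB f X Y U mu Lu).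
Context (hC2 : assumptionC2 f X Y).
Context (rho_gt0 : 0 < rho).
Context (hC3 : assumptionC3 rho mu Lx Ly gamma beta).
Context (hxy : HiBSA f h g X Y U rho gamma beta x y).

Lemma iterate_x_in r : (1 <= r)%N -> block_prod X (x r).
Proof.
case: r => // -[|r] _; first exact: (HiBSA_x1 hxy).
by move=> i; have [] := HiBSA_x hxy (ltn0Sn r) i.
Qed.

Lemma iterate_y_in r : (1 <= r)%N -> Y (y r).
Proof.
case: r => // -[|r] _; first exact: (HiBSA_y1 hxy).
by have [] := HiBSA_y hxy (ltn0Sn r).
Qed.

Let w r (i : 'I_K.+1) := partial_update (x r.+1) (x r) i.

Let w_in r i : (1 <= r)%N -> block_prod X (w r i).
Proof. by move=> r1; apply: sweep_in; apply: iterate_x_in. Qed.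

Lemma block_var_ineq r i : (1 <= r)%N ->
  var_ineq (X i) (h i)
    (grad (fun u => U i u (w r i) (y r)) (row i (x r.+1))
     + beta r *: (row i (x r.+1) - row i (x r))) (row i (x r.+1)).
Proof.
move=> r1; apply: minimizer_var_ineq.
- exact: (A1_convex_X hA).
- exact: (A2_convex_h hA).
- by apply: (B_differentiable hB); [exact: w_in|exact: iterate_y_in|
    exact: iterate_x_in].
- exact: (HiBSA_x hxy).
Qed.

(** Each block step decreases the surrogate by its strong convexity modulus
    plus the proximal term. As the surrogate is tight at the old block and
    lies above the objective, this decrease passes to the objective. *)
Lemma block_descent r (i : 'I_K.+1) : (1 <= r)%N ->
  f (sweep (x r.+1) (x r) i.+1, y r) + h i (row i (x r.+1))
    + (beta r + min_modulus mu / 2)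
      * dot (row i (x r.+1) - row i (x r)) (row i (x r.+1) - row i (x r))
  <= f (sweep (x r.+1) (x r) i, y r) + h i (row i (x r)).
Proof.
move=> r1; have Yr := iterate_y_in r1; have Xr := iterate_x_in r1.
have Xr' := iterate_x_in (leqW r1); have Xw := w_in i r1.
have [_ /(_ _ (Xr i)) vi] := block_var_ineq i r1.
have sc := B1_strongly_convex hB Xw Yr (Xr i) (Xr' i).
have up := B3_upper_bound hB Xw Yr (Xr' i).
have tight := B3_tight hB i Xw Yr.
rewrite [row i (w r i)](_ : _ = row i (x r)) in tight; last first.
  by rewrite rowK ltnn.
rewrite (sweepS (x r.+1) (x r) i) in up.
rewrite -/(sweep (x r.+1) (x r) i) in tight.
rewrite enorm_sqr in sc; rewrite dotDl dotZl in vi.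
set G := dot (grad _ _) _ in sc vi.
set d := row i (x r.+1) - row i (x r) in vi *.
have dN : row i (x r) - row i (x r.+1) = - d by rewrite opprB.
rewrite dN !dotNr dotNl opprK in vi sc.
have mui : min_modulus mu <= mu i by exact: bigmin_le.
have : min_modulus mu * dot d d <= mu i * dot d d.
  by apply: ler_wpM2r => //; exact: dot_ge0.
move: vi sc up tight; rewrite -/(w r i); lra.
Qed.

Lemma sweep_descent r : (1 <= r)%N ->
  ell f h g (x r.+1) (y r) + (beta r + min_modulus mu / 2)
      * dot (x r.+1 - x r) (x r.+1 - x r)
  <= ell f h g (x r) (y r).
Proof.
move=> r1; pose F n := f (sweep (x r.+1) (x r) n, y r).
have tel : F K.+1 - F 0%N = \sum_(i < K.+1) (F i.+1 - F i).
  by rewrite -(big_mkord xpredT (fun i => F i.+1 - F i)) telescope_sumr.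
have : \sum_(i < K.+1) (F i.+1 - F i + h i (row i (x r.+1))
    - h i (row i (x r)) + (beta r + min_modulus mu / 2)
      * dot (row i (x r.+1) - row i (x r)) (row i (x r.+1) - row i (x r))) <= 0.
  apply: sumr_le0 => i _; have := block_descent i r1; rewrite -/(F i) -/(F i.+1).
  lra.
rewrite big_split sumrB big_split /= -tel -mulr_sumr.
rewrite (_ : \sum_i dot _ _ = dot (x r.+1 - x r) (x r.+1 - x r)); last first.
  by rewrite dot_rows; apply: eq_bigr => i _; rewrite linearB.
rewrite /F sweep_full sweep0 /ell; lra.
Qed.

Local Notation gap b r := (stationarity_gap f h g X Y b rho (x r) (y r)).

Definition gap_constant : R := 4 * \sum_(i < K.+1) (Lu i ^+ 2 + Lx i ^+ 2).

(** Both [x_i^(r+1)] and the proximal point defining the gap solve the same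
    variational inequality up to a perturbation of the gradient, and that
    perturbation is Lipschitz in the step because the surrogate has the right
    gradient at its base point. *)
Lemma gap_x_bound r : (1 <= r)%N -> 0 < beta r ->
  dot (gap (beta r) r).1 (gap (beta r) r).1 <= (2 * beta r ^+ 2 + gap_constant)
             * dot (x r.+1 - x r) (x r.+1 - x r).
Proof.
move=> r1 b0; set G := (gap _ _).1; have Yr := iterate_y_in r1; have Xr := iterate_x_in r1.
have Xr' := iterate_x_in (leqW r1).
set D := dot (x r.+1 - x r) (x r.+1 - x r).
have D0 : 0 <= D by exact: dot_ge0.
have rowG i : dot (row i G) (row i G) <=
    2 * beta r ^+ 2 * dot (row i (x r.+1 - x r)) (row i (x r.+1 - x r))
    + 4 * (Lu i ^+ 2 + Lx i ^+ 2) * D.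
  set di := row i (x r.+1 - x r).
  have diE : di = row i (x r.+1) - row i (x r) by rewrite /di linearB.
  have Xw := w_in i r1.
  pose c := row i (gradx f (x r) (y r)).
  pose p' := Px h X i (beta r) (row i (x r) - (beta r)^-1 *: c).
  have vi' : var_ineq (X i) (h i) (c + beta r *: (p' - row i (x r))) p'.
    have -> : c + beta r *: (p' - row i (x r)) =
        beta r *: (p' - (row i (x r) - (beta r)^-1 *: c)).
      rewrite (_ : p' - (_ - _) = (beta r)^-1 *: c + (p' - row i (x r))).
        by rewrite [RHS]scalerDr scalerA mulfV ?gt_eqF// scale1r.
      by rewrite opprB addrCA.
    apply: Px_var_ineq; first by exists (row i (x r)); exact: Xr.
    - exact: (A1_compact_X hA).
    - exact: (A1_convex_X hA).
    - exact: (A2_convex_h hA).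
  have st := var_ineq_stable b0 (block_var_ineq i r1) vi'.
  set q := grad _ _ in st; set p := row i (x r.+1) in st.
  have gm := B2_gradient_match hB i Xw Yr.
  rewrite [row i (w r i)](_ : _ = row i (x r)) in gm; last first.
    by rewrite rowK ltnn.
  have lu : dot (q - row i (gradx f (w r i) (y r)))
               (q - row i (gradx f (w r i) (y r))) <= Lu i ^+ 2 * D.
    rewrite -gm; have := B4_lipschitz hB Xw Yr (Xr i) (Xr' i).
    rewrite -[enorm (row i (x r) - _)](_ : enorm_pair (row i (x r) - p, 0 : 'rV[R]_N) = _); last first.
      rewrite /enorm_pair /= (_ : enorm 0 = 0) ?expr0n ?addr0.
        by rewrite enorm_sqr.
      by rewrite /enorm dot0 sqrtr0.
    move/ler_enorm_sqr/le_trans; apply; apply: ler_wpM2l; first exact: sqr_ge0.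
    rewrite /= dot0 addr0 -opprB -diE dotNl dotNr opprK /D [leRHS]dot_rows (bigD1 i)//=.
    by rewrite lerDl sumr_ge0// => j _; exact: dot_ge0.
  have lx : dot (row i (gradx f (w r i) (y r)) - c)
               (row i (gradx f (w r i) (y r)) - c) <= Lx i ^+ 2 * D.
    have /ler_enorm_sqr := A3_lipschitz_x hA i Xr Yr Xw Yr.
    move/le_trans; apply; apply: ler_wpM2l; first exact: sqr_ge0.
    by rewrite /= subrr dot0 addr0; exact: dot_sweep_le.
  have -> : row i G = - (beta r *: di) + beta r *: (p - p').
    rewrite rowK -/c -/p' diE -/p -scalerN -scalerDr; congr (_ *: _).
    by rewrite opprB addrA subrK.
  exact: (dot_perturbed_step di st lu lx).
rewrite dot_rows; apply: le_trans (ler_sum _ (fun i _ => rowG i)) _.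
rewrite big_split /= -mulr_sumr -mulr_suml -mulr_sumr.
by rewrite -(dot_rows (x r.+1 - x r)) -/D /gap_constant; lra.
Qed.

Let slice_differentiable x0 u : differentiable (fun u => f (x0, u)) u.
Proof.
apply: (@differentiable_comp _ _ _ _ (fun u => (x0, u)) f); last first.
  exact: (A1_differentiable hA).
exact: differentiable_pair.
Qed.

Lemma ascent_optimality r : (1 <= r)%N ->
  var_ineq Y g (- grady f (x r.+1) (y r.+1) + rho^-1 *: (y r.+1 - y r)
                + gamma r *: y r.+1) (y r.+1).
Proof.
move=> r1; apply: ascent_var_ineq => //.
- exact: (C3_gamma_gt0 hC3).
- exact: (A1_convex_Y hA).
- exact: (A2_convex_g hA).
- exact: (HiBSA_y hxy).
Qed.

Lemma gap_y_bound r b : (1 <= r)%N ->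
  dot (gap b r.+1).2 (gap b r.+1).2 <= 2 * rho^-1 ^+ 2 * dot (y r.+1 - y r) (y r.+1 - y r)
             + 2 * gamma r ^+ 2 * dot (y r.+1) (y r.+1).
Proof.
move=> r1; set G := (gap _ _).2; have Yr' := iterate_y_in (leqW r1).
have ri0 : 0 < rho^-1 by rewrite invr_gt0.
pose c := grady f (x r.+1) (y r.+1).
pose p' := Py g Y rho (y r.+1 + rho *: c).
have vi' : var_ineq Y g (- c + rho^-1 *: (p' - y r.+1)) p'.
  have -> : - c + rho^-1 *: (p' - y r.+1) =
      rho^-1 *: (p' - (y r.+1 + rho *: c)).
    rewrite (_ : p' - (_ + _) = - (rho *: c) + (p' - y r.+1)).
      by rewrite [RHS]scalerDr scalerN scalerA mulVf ?gt_eqF// scale1r.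
    by rewrite opprD addrA addrC.
  apply: Py_var_ineq; first by exists (y r.+1).
  - exact: (A1_compact_Y hA).
  - exact: (A1_convex_Y hA).
  - exact: (A2_convex_g hA).
have vi : var_ineq Y g (- c + rho^-1 *: (y r.+1 - y r) + gamma r *: y r.+1
    + rho^-1 *: (y r.+1 - y r.+1)) (y r.+1).
  by rewrite subrr scaler0 addr0; exact: ascent_optimality.
have st := var_ineq_stable ri0 vi vi'.
rewrite /G/= -/c -/p' dotZl dotZr mulrA -expr2; apply: (le_trans st).
rewrite (_ : _ - - c = rho^-1 *: (y r.+1 - y r) + gamma r *: y r.+1); last first.
  by rewrite opprK addrC !addrA subrr add0r.
by apply: le_trans (dot_sqrD _ _) _; rewrite !dotZl !dotZr !expr2; lra.
Qed.

Lemma gamma_le_first r : (1 <= r)%N -> gamma r <= gamma 1%N.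
Proof.
elim: r => // -[|r] IH _ //; apply: le_trans (IH _) => //.
by rewrite -subr_ge0; exact: (C3_gamma_decr hC3).
Qed.

(** Decrease of the potential per unit of squared primal step: the block
    descent minus what the dual step gives back. *)
Definition primal_decrease r : R :=
  beta r + min_modulus mu / 2
  - (rho * Ly ^+ 2 / 2 + 2 * Ly ^+ 2 / (rho * gamma r ^+ 2)).

Definition decrease r : R :=
  primal_decrease r.+1 * dot (x r.+2 - x r.+1) (x r.+2 - x r.+1)
  + 1 / (20 * rho) * dot (y r.+2 - y r.+1) (y r.+2 - y r.+1).

(** [H] is meant to bound the ratios of consecutive values of [gamma], and [D]
    the squared norms of the points of [Y]. The term in [dot (y r.+1) (y r.+1)]
    absorbs the regularization of the dual step, and the last term pays for the
    decrease of [gamma]. *)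
Definition potential (H D : R) r : R :=
  ell f h g (x r.+1) (y r.+1)
  + (2 / (rho ^+ 2 * gamma r) + 9 / (10 * rho))
    * dot (y r.+1 - y r) (y r.+1 - y r)
  - gamma r / 2 * dot (y r.+1) (y r.+1) + (16 * H + 2^-1) * D * gamma r.

Lemma potential_descent H D r : (1 <= r)%N ->
  1 + gamma 1%N * rho / 5 <= H -> (forall u, Y u -> dot u u <= D) ->
  potential H D r.+1 + decrease r <= potential H D r.
Proof.
move=> r1 Hb Db; have r2 := leqW r1; have r3 := leqW r2.
have := sweep_descent r2.
have Hr : 1 + gamma r * rho / 5 <= H.
  apply: le_trans Hb; rewrite lerD2l -!mulrA ler_wpM2r ?gamma_le_first//.
  by rewrite divr_ge0// ltW.
have cc' : gamma r.+1 <= gamma r.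
  by rewrite -subr_ge0; exact: (C3_gamma_decr hC3).
have /ler_enorm_sqr := A3_lipschitz_y hA (iterate_x_in r2) (iterate_y_in r2)
  (iterate_x_in r3) (iterate_y_in r2).
rewrite /= subrr dot0 addr0 => lip.
have [_ /(_ _ (iterate_y_in r3)) vi1] := ascent_optimality r1.
have [_ /(_ _ (iterate_y_in r2)) vi2] := ascent_optimality r2.
have := proximal_ascent_step rho_gt0 (C3_gamma_gt0 hC3 r2) cc'
  (C3_gamma_slow hC3 r1) Hr (Db _ (iterate_y_in r2)) (Db _ (iterate_y_in r3))
  vi1 vi2 (hC2 (iterate_x_in r3) (iterate_y_in r3) (iterate_y_in r2))
  (hC2 (iterate_x_in r3) (iterate_y_in r2) (iterate_y_in r3)) lip.
rewrite /potential /decrease /primal_decrease /ell.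
move: (\sum_i _) (\sum_i _) => s1 s2.
move: (dot (x _ - _) _) (dot (y r.+2 - _) _) (dot (y r.+1 - _) _) => X1 d2 d1.
lra.
Qed.

Lemma potential_ge H D r : (1 <= r)%N -> 0 <= H ->
  (forall u, Y u -> dot u u <= D) ->
  l_low - gamma 1%N / 2 * D <= potential H D r.
Proof.
move=> r1 H0 Db; have r2 := leqW r1.
have low := A1_lower_bound hA (iterate_x_in r2) (iterate_y_in r2).
have g0 := C3_gamma_gt0 hC3 r1.
have Dy := Db _ (iterate_y_in r2).
have D0 : 0 <= D := le_trans (dot_ge0 _) Dy.
have t1 : 0 <= (2 / (rho ^+ 2 * gamma r) + 9 / (10 * rho))
    * dot (y r.+1 - y r) (y r.+1 - y r).
  rewrite mulr_ge0 ?dot_ge0// addr_ge0// divr_ge0// mulr_ge0 ?ltW//.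
  by rewrite exprn_gt0.
have t2 : 0 <= (16 * H + 2^-1) * D * gamma r.
  by rewrite !mulr_ge0 ?addr_ge0 ?mulr_ge0// ltW.
have t3 : gamma r / 2 * dot (y r.+1) (y r.+1) <= gamma 1%N / 2 * D.
  apply: ler_pM => //; [by rewrite divr_ge0// ltW|exact: dot_ge0|].
  by rewrite ler_wpM2r ?gamma_le_first.
rewrite /potential; move: low t1 t2 t3.
move: (ell _ _ _ _ _) (dot (y r.+1 - _) _) => l d; lra.
Qed.

(** If [Lx i < 0], the Lipschitz inequality bounds a norm by a nonpositive
    multiple of the distance, so every distance in [X * Y] is 0. *)
Lemma lipschitz_ge0_or_single :
  (forall i, 0 <= Lx i) \/
  (forall x0 x1 y0 y1, block_prod X x0 -> block_prod X x1 -> Y y0 -> Y y1 ->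
     x0 = x1 /\ y0 = y1).
Proof.
have [[i Li]|L0] := pselect (exists i, Lx i < 0); last first.
  by left => i; rewrite leNgt; apply/negP => Li; apply: L0; exists i.
right => x0 x1 y0 y1 X0 X1 Y0 Y1.
have lip := A3_lipschitz_x hA i X1 Y1 X0 Y0.
have e0 : 0 <= enorm_pair (x0 - x1, y0 - y1) by exact: sqrtr_ge0.
have {lip}: 0 <= Lx i * enorm_pair (x0 - x1, y0 - y1).
  by apply: le_trans lip; exact: sqrtr_ge0.
rewrite nmulr_rge0// => e1.
have := enorm_pair_sqr (x0 - x1, y0 - y1).
rewrite (_ : enorm_pair _ = 0); last by apply/eqP; rewrite eq_le e1 e0.
rewrite expr0n /= => /esym/eqP; rewrite paddr_eq0 ?dot_ge0//.
by move=> /andP[/eqP/dot_eq0/subr0_eq -> /eqP/dot_eq0/subr0_eq ->].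
Qed.

Lemma gap_single b r : (1 <= r)%N ->
  (forall x0 x1 y0 y1, block_prod X x0 -> block_prod X x1 -> Y y0 -> Y y1 ->
     x0 = x1 /\ y0 = y1) ->
  enorm_pair (gap b r) = 0.
Proof.
move=> r1 single; have Xr := iterate_x_in r1; have Yr := iterate_y_in r1.
suff -> : gap b r = (0, 0) by rewrite /enorm_pair !enorm_sqr !dot0 addr0 sqrtr0.
congr pair.
  apply/row_matrixP => i; rewrite rowK row0.
  set p := Px _ _ _ _ _.
  have [Xp _] : var_ineq (X i) (h i)
      (b *: (p - (row i (x r) - b^-1 *: row i (gradx f (x r) (y r))))) p.
    apply: Px_var_ineq; first by exists (row i (x r)); exact: Xr.
    - exact: (A1_compact_X hA).
    - exact: (A1_convex_X hA).
    - exact: (A2_convex_h hA).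
  have Xs : block_prod X (set_block (x r) i p).
    by move=> k /=; rewrite rowK; case: eqP => [->|_] //; exact: Xr.
  have [E _] := single _ _ _ _ Xr Xs Yr Yr.
  by rewrite [in X in X - _]E rowK eqxx subrr scaler0.
set p := Py _ _ _ _.
have [Yp _] : var_ineq Y g
    (rho^-1 *: (p - (y r + rho *: grady f (x r) (y r)))) p.
  apply: Py_var_ineq; first by exists (y r).
  - exact: (A1_compact_Y hA).
  - exact: (A1_convex_Y hA).
  - exact: (A2_convex_g hA).
have [_ <-] := single _ _ _ _ Xr Xr Yr Yp.
by rewrite subrr scaler0.
Qed.

(** Two consecutive decreases are involved because the primal part of the gap
    is compared with the next iterate and its dual part with the previous
    one. *)
Lemma gap_sqr_le D c0 r : (1 <= r)%N -> 0 < c0 -> 0 < beta r.+2 ->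
  (forall u, Y u -> dot u u <= D) ->
  c0 * (beta r.+1 + 1) <= primal_decrease r.+1 -> 0 <= beta r.+1 ->
  c0 * (beta r.+2 + 1) <= primal_decrease r.+2 ->
  enorm_pair (gap (beta r.+2) r.+2) ^+ 2
    <= (2 + gap_constant) / c0 * (beta r.+2 + 1) * decrease r.+1
       + 40 / rho * decrease r + 2 * D * gamma r.+1 ^+ 2.
Proof.
move=> r1 c00 b0 Db k1 b1 k2.
have := gap_x_bound (leqW (leqW r1)) b0.
have := gap_y_bound (beta r.+2) (leqW r1).
have := Db _ (iterate_y_in (leqW (leqW r1))).
rewrite enorm_pair_sqr /decrease.
move: (dot (gap _ _).1 _) (dot (gap _ _).2 _) => g1 g2.
have := dot_ge0 (x r.+3 - x r.+2); have := dot_ge0 (x r.+2 - x r.+1).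
have := dot_ge0 (y r.+3 - y r.+2); have := dot_ge0 (y r.+2 - y r.+1).
move: (dot (x r.+3 - _) _) (dot (x r.+2 - _) _) => X2 X1.
move: (dot (y r.+3 - _) _) (dot (y r.+2 - _) _) (dot (y _) _) => d2 d1 s.
move=> d10 d20 X10 X20 sD yb xb.
have C0 : 0 <= gap_constant.
  by rewrite mulr_ge0// sumr_ge0// => i _; rewrite addr_ge0// sqr_ge0.
have kk1 : 0 <= primal_decrease r.+1.
  by apply: le_trans k1; rewrite mulr_ge0 ?addr_ge0// ltW.
set C := gap_constant in xb C0 *.
have hx : (2 * beta r.+2 ^+ 2 + C) * X2 <=
    (2 + C) / c0 * (beta r.+2 + 1) * (primal_decrease r.+2 * X2).
  have F0 : 0 <= (2 + C) / c0 * (beta r.+2 + 1).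
    by rewrite mulr_ge0 ?divr_ge0 ?addr_ge0// ltW.
  rewrite mulrA; apply: ler_wpM2r => //.
  apply: le_trans (ler_wpM2l F0 k2).
  have -> : (2 + C) / c0 * (beta r.+2 + 1) * (c0 * (beta r.+2 + 1)) =
    (2 + C) * (beta r.+2 + 1) ^+ 2 by field; rewrite gt_eqF.
  have b2 : 0 <= beta r.+2 ^+ 2 by exact: sqr_ge0.
  have Cb := mulr_ge0 C0 (ltW b0); have Cb2 := mulr_ge0 C0 b2.
  by move: b0 Cb Cb2; rewrite !expr2; lra.
have hx' : 0 <= (2 + C) / c0 * (beta r.+2 + 1) * (1 / (20 * rho) * d2).
  apply: mulr_ge0; first by rewrite mulr_ge0 ?divr_ge0 ?addr_ge0// ltW.
  by rewrite mulr_ge0// divr_ge0// mulr_ge0// ltW.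
have hy : 2 * rho^-1 ^+ 2 * d1 = 40 / rho * (1 / (20 * rho) * d1).
  by field; rewrite gt_eqF.
have hy' : 0 <= 40 / rho * (primal_decrease r.+1 * X1).
  by rewrite mulr_ge0 ?divr_ge0 ?mulr_ge0// ltW.
have hs : gamma r.+1 ^+ 2 * s <= gamma r.+1 ^+ 2 * D.
  by apply: ler_wpM2l => //; exact: sqr_ge0.
rewrite hy in yb; move: hs hy' hx' hx xb yb.
move: (primal_decrease _) (primal_decrease _) (40 / _) (1 / _) ((2 + C) / _) => p1 p2 t1 t2 t3.
lra.
Qed.

End iterates.

(** * Growth of the parameters *)

Lemma min_modulus_gt0 (R : realType) K (mu : 'I_K.+1 -> R) :
  (forall i, 0 < mu i) -> 0 < min_modulus mu.
Proof. by move=> mu0; apply/lt_bigmin. Qed.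

Section parameters.
Context {R : realType} {K : nat}.
Implicit Types (gamma beta : nat -> R).

(** If [Ly = 0], the dual step gives nothing back, and [mu / 2] supplies the
    constant term. Otherwise the lower bound on [beta r] contains twice the
    loss, which grows past any constant as [gamma r] tends to 0. *)
Lemma primal_decrease_ge (rho : R) (mu Lx : 'I_K.+1 -> R) Ly gamma beta :
  0 < rho -> (forall i, 0 < mu i) -> assumptionC3 rho mu Lx Ly gamma beta ->
  (forall r, (1 <= r)%N -> 0 <= beta r) ->
  exists c0 n0, 0 < c0 /\ forall r, (n0 <= r)%N ->
    c0 * (beta r + 1) <= primal_decrease Ly mu rho gamma beta r.
Proof.
move=> rho0 mu0 hC3 b0; set m := min_modulus mu.
have m0 : 0 < m by exact: min_modulus_gt0.
have [L0|L0] := eqVneq Ly 0.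
  exists (Num.min 1 (m / 2)), 1%N; split=> [|r r1].
    by rewrite lt_min ltr01 divr_gt0.
  rewrite /primal_decrease L0 expr0n/= !mulr0 !mul0r addr0 subr0 mulrDr mulr1.
  apply: lerD; last by rewrite ge_min lexx orbT.
  rewrite -[leRHS]mul1r; apply: ler_wpM2r; first exact: b0.
  by rewrite ge_min lexx.
have L2 : 0 < Ly ^+ 2 by rewrite exprn_even_gt0.
(* [gamma r < e] implies [gamma r ^+ 2 <= e], and then the loss is at least
   [2 * m + 1] *)
pose e := Num.min 1 (2 * Ly ^+ 2 / (rho * (2 * m + 1))).
have D0 : 0 < rho * (2 * m + 1) by rewrite mulr_gt0 ?addr_gt0 ?mulr_gt0.
have e0 : 0 < e by rewrite lt_min ltr01 divr_gt0// mulr_gt0.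
have /cvgrPdist_lt/(_ _ e0)[n0 _ Hn] := C3_gamma_cvg0 hC3.
exists (1 / 8), n0.+1; split=> [|r nr]; first by lra.
have r1 : (1 <= r)%N by apply: leq_ltn_trans nr.
have := Hn r (ltnW nr); have gr0 := C3_gamma_gt0 hC3 r1.
rewrite sub0r normrN gtr0_norm// lt_min => /andP[g1 ge].
have g2 : rho * gamma r ^+ 2 * (2 * m + 1) <= 2 * Ly ^+ 2.
  move: ge; rewrite ltr_pdivlMr// => ge.
  apply: le_trans (ltW ge); rewrite mulrAC mulrC ler_wpM2r//; first exact: ltW.
  by rewrite expr2 -[leRHS]mul1r ler_wpM2r// ltW.
have rg : 0 < rho * gamma r ^+ 2 by rewrite mulr_gt0// exprn_gt0.
have q1 : 2 * m + 1 <= 2 * Ly ^+ 2 / (rho * gamma r ^+ 2).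
  by rewrite ler_pdivlMr// mulrC.
have bd := C3_beta_descent hC3 r1; rewrite -/m in bd.
have E : 4 * Ly ^+ 2 / (rho * gamma r ^+ 2) =
  2 * (2 * Ly ^+ 2 / (rho * gamma r ^+ 2)) by ring.
have rL : 0 < rho * Ly ^+ 2 by rewrite mulr_gt0.
rewrite /primal_decrease -/m; rewrite E in bd.
move: bd rL q1 (b0 _ r1) m0; move: (2 * Ly ^+ 2 / _) => q.
lra.
Qed.

Lemma sqr_powR_quarter (r : nat) :
  ((r%:R : R) `^ (- 4^-1)) ^+ 2 = (Num.sqrt r%:R)^-1.
Proof.
rewrite -powR_mulrn ?powR_ge0// -powRrM.
have -> : - 4^-1 * 2%:R = - 2^-1 :> R by field.
by rewrite powRN powR12_sqrt.
Qed.

Lemma parameter_growth gamma beta :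
  gamma =Theta_\oo (fun r : nat => r%:R `^ (- 4^-1) : R) ->
  beta =O_\oo (fun r : nat => gamma r ^- 2) ->
  exists C n0, 0 < C /\ forall r, (n0 <= r)%N ->
    gamma r ^+ 2 <= C / Num.sqrt r%:R /\ beta r + 1 <= C * Num.sqrt r%:R.
Proof.
rewrite eqThetaE qualifE => /asboolP[[k1 k2] /= /andP[k10 k20] [n1 _ Hg]].
move=> /eqO_exP[k3 k30 [n2 _ Hb]].
exists (k2 ^+ 2 + k3 / k1 ^+ 2 + 1), (maxn 1 (maxn n1 n2)).
have i0 : 0 <= k3 / k1 ^+ 2 by rewrite divr_ge0 ?ltW// exprn_gt0.
split=> [|r]; first by rewrite ltr_wpDl ?addr_ge0// sqr_ge0.
rewrite !geq_max => /and3P[r1 r2 r3].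
have [] := Hg r r2; have := Hb r r3; move=> /= hb hl hu.
set s := Num.sqrt r%:R.
have s1 : 1 <= s by rewrite -sqrtr1 ler_sqrt// ler1n.
have s0 : 0 < s := lt_le_trans ltr01 s1.
have si0 : 0 <= s^-1 by rewrite invr_ge0 ltW.
have p0 : 0 <= (r%:R : R) `^ (- 4^-1) by exact: powR_ge0.
rewrite (ger0_norm p0) in hl hu.
have gu : gamma r ^+ 2 <= k2 ^+ 2 * s^-1.
  rewrite -sqr_powR_quarter -exprMn -real_normK ?num_real//.
  by rewrite ler_pXn2r// nnegrE ?normr_ge0// mulr_ge0// ltW.
have gl : k1 ^+ 2 * s^-1 <= gamma r ^+ 2.
  rewrite -sqr_powR_quarter -exprMn -[leRHS]real_normK ?num_real//.
  by rewrite ler_pXn2r// nnegrE ?normr_ge0// mulr_ge0// ltW.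
split.
  apply: (le_trans gu); apply: ler_wpM2r => //.
  by rewrite -addrA lerDl addr_ge0.
have gi : gamma r ^- 2 <= s / k1 ^+ 2.
  have k12 : 0 < k1 ^+ 2 by rewrite exprn_gt0.
  have -> : s / k1 ^+ 2 = (k1 ^+ 2 * s^-1)^-1 by field; rewrite !gt_eqF.
  by rewrite lef_pV2// posrE ?(lt_le_trans _ gl)// mulr_gt0// invr_gt0.
have gp : 0 <= gamma r ^- 2 by rewrite invr_ge0 sqr_ge0.
rewrite (ger0_norm gp) in hb.
have b1 : beta r <= k3 / k1 ^+ 2 * s.
  apply: le_trans (ler_norm _) (le_trans hb _).
  by rewrite mulrAC -mulrA ler_pM2l// mulrC.
have k2s : 0 <= k2 ^+ 2 * s by rewrite mulr_ge0 ?sqr_ge0// ltW.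
by rewrite !mulrDl; lra.
Qed.

End parameters.

(** * From summable decreases to the iteration count *)

(** Combines [gap_sqr_le] with the growth of the parameters: [e0] and [e1] are
    consecutive decreases, [s] is [sqrt r], and [b] and [c] stand for
    [beta r.+2 + 1] and [gamma r.+1 ^+ 2]. *)
Lemma gap_rate_bound (R : realType) (A k q D C s e0 e1 b c : R) :
  1 <= s -> 0 <= k -> 0 <= q -> 0 <= D -> 0 <= C -> 0 <= e0 -> 0 <= e1 ->
  b <= 2 * C * s -> c <= C / s ->
  A <= k * b * e1 + q * e0 + 2 * D * c ->
  A <= (k * (2 * C) + q + 2 * D * C) * s * (e0 + e1)
       + (k * (2 * C) + q + 2 * D * C) / s.
Proof.
move=> s1 k0 q0 D0 C0 e00 e10 bC cC /le_trans; apply.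
have s0 : 0 <= s by apply: le_trans s1.
have kC : 0 <= k * (2 * C) by rewrite !mulr_ge0.
have DC : 0 <= 2 * D * C by rewrite !mulr_ge0.
have t1 : k * b * e1 <= k * (2 * C) * (s * e1).
  by rewrite -!mulrA ler_wpM2l// !mulrA ler_wpM2r.
have t2 : q * e0 <= q * (s * e0) by rewrite ler_wpM2l// ler_peMl.
have t3 : 2 * D * c <= 2 * D * C / s.
  by rewrite -[leRHS]mulrA ler_wpM2l// mulr_ge0.
have p0 := mulr_ge0 kC (mulr_ge0 s0 e00).
have p1 := mulr_ge0 q0 (mulr_ge0 s0 e10).
have p2 := mulr_ge0 DC (mulr_ge0 s0 (addr_ge0 e00 e10)).
have p3 : 0 <= (k * (2 * C) + q) / s by rewrite divr_ge0// addr_ge0.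
rewrite (mulrDl (_ + _) (2 * D * C) s^-1) addrA; apply: lerD => //.
by rewrite -[leLHS]addr0; apply: lerD => //; lra.
Qed.

Section averaging.
Context {R : realType}.
Implicit Types (a P d : nat -> R).

(** The decreases over [n <= r < 2 * n] add up to at most a constant, so one of
    them is [O(n^-1)]; the factor [sqrt r] costs half a power of [n]. *)
Lemma small_gap_in_window a P d (low C : R) n0 : 0 <= C ->
  (forall r, (n0 <= r)%N -> [/\ 0 <= d r, P r.+1 + d r <= P r & low <= P r]) ->
  (forall r, (n0 <= r)%N -> a r <= C * Num.sqrt r%:R * (d r + d r.+1)
                                   + C / Num.sqrt r%:R) ->
  exists2 B, 0 < B & forall n, (n0 <= n)%N -> (1 <= n)%N ->
    exists2 r, (n <= r < n.*2)%N & a r <= B / Num.sqrt n%:R.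
Proof.
move=> C0 hP ha; pose S := P n0 - low.
have S0 : 0 <= S by rewrite subr_ge0; have [] := hP n0 (leqnn _).
have Pdecr r k : (n0 <= r)%N -> P (r + k)%N <= P r.
  move=> nr; elim: k => [|k IH]; first by rewrite addn0.
  have [] := hP (r + k)%N (leq_trans nr (leq_addr _ _)).
  by rewrite addnS => d0 le _; lra.
have sumd n m : (n0 <= n)%N -> (n <= m)%N ->
    \sum_(n <= r < m) (d r + d r.+1) <= (P n - P m) + (P n.+1 - P m.+1).
  move=> nn; elim: m => [|m IH].
    by rewrite leqn0 => /eqP ->; rewrite big_geq// !subrr addr0.
  rewrite leq_eqVlt => /orP[/eqP <-|nm]; first by rewrite big_geq// !subrr addr0.
  rewrite ltnS in nm; rewrite big_nat_recr//=.
  have := IH nm; have [_ h1 _] := hP m (leq_trans nn nm).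
  have [_ h2 _] := hP m.+1 (leqW (leq_trans nn nm)); lra.
exists (4 * C * S + C + 1) => [|n nn n1].
  by rewrite ltr_wpDl// addr_ge0// !mulr_ge0.
have n_gt0 : 0 < n%:R :> R by rewrite ltr0n.
have [r rn dr] : exists2 r, (n <= r < n.*2)%N & d r + d r.+1 <= 2 * S / n%:R.
  apply: contrapT => none.
  have big r : (n <= r < n.*2)%N -> 2 * S / n%:R < d r + d r.+1.
    by move=> rn; rewrite ltNge; apply/negP => le; apply: none; exists r.
  have : \sum_(n <= r < n.*2) (d r + d r.+1) <= 2 * S.
    apply: (le_trans (sumd _ _ nn _)); first by rewrite -addnn leq_addr.
    have [_ _ l1] := hP n.*2 (leq_trans nn (leq_trans (leq_addr n n) (eq_leq (addnn n)))).
    have [_ _ l2] := hP n.*2.+1 (leqW (leq_trans nn (leq_trans (leq_addr n n) (eq_leq (addnn n))))).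
    have := Pdecr n0 (n - n0)%N (leqnn _); have := Pdecr n0 (n.+1 - n0)%N (leqnn _).
    by rewrite !subnKC ?leqW// /S; lra.
  apply/negP; rewrite -ltNge.
  have -> : 2 * S = \sum_(n <= r < n.*2) (2 * S / n%:R).
    rewrite sumr_const_nat -addnn addnK -[RHS]mulr_natr mulfVK// gt_eqF//.
  apply: ltr_sum_nat => //.
  by rewrite -addnn -[X in (X < _)%N]addn0 ltn_add2l.
exists r => //; have /andP[nr rn2] := rn.
have nr0 := leq_trans nn nr.
apply: (le_trans (ha r nr0)).
set s := Num.sqrt n%:R; set t := Num.sqrt r%:R.
have s0 : 0 < s by rewrite sqrtr_gt0.
have st : s <= t by rewrite ler_sqrt ?ler_nat// ltr0n (leq_trans n1).
have t2 : t <= 2 * s.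
  have -> : 2 = Num.sqrt (2 ^+ 2) :> R by rewrite sqrtr_sqr ger0_norm.
  rewrite -sqrtrM ?sqr_ge0// ler_sqrt ?mulr_gt0 ?exprn_gt0// -natrX -natrM.
  by rewrite ler_nat (leq_trans (ltnW rn2))// -muln2 mulnC leq_mul2r orbT.
have ss : n%:R = s ^+ 2 :> R by rewrite sqr_sqrtr// ltW.
have h1 : C * t * (d r + d r.+1) <= C * (2 * s) * (2 * S / n%:R).
  have [d0 _ _] := hP r nr0; have [d1 _ _] := hP r.+1 (leqW nr0).
  apply: ler_pM => //; first by rewrite mulr_ge0// ltW// (lt_le_trans s0).
    exact: addr_ge0.
  exact: ler_wpM2l.
have h2 : C / t <= C / s.
  by apply: ler_wpM2l => //; rewrite lef_pV2// posrE (lt_le_trans s0).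
have -> : (4 * C * S + C + 1) / s = C * (2 * s) * (2 * S / n%:R) + C / s + s^-1.
  by rewrite ss; field; rewrite gt_eqF.
have : 0 <= s^-1 by rewrite invr_ge0 ltW.
by lra.
Qed.

(** A window at [n ~ B ^ 2 / eps ^ 4] already contains a point of gap
    [eps]. *)
Lemma first_hit_rate (a : nat -> R) (B : R) n0 : 0 < B ->
  (forall r, 0 <= a r) ->
  (forall n, (n0 <= n)%N -> (1 <= n)%N ->
     exists2 r, (1 <= r <= n.*2)%N & a r ^+ 2 <= B / Num.sqrt n%:R) ->
  exists T : R -> nat,
    (forall eps : R, 0 < eps -> first_hit a eps (T eps)) /\
    soft_bigO (0^'+ : set_system R)
      (fun eps => (T eps)%:R) (fun eps => eps ^- 4).
Proof.
move=> B0 a0 ha.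
pose N (eps : R) := (n0 + (Num.truncn (B ^+ 2 * eps ^- 4)).+1)%N.
have hit (eps : R) : 0 < eps ->
    exists2 r, (1 <= r <= (N eps).*2)%N & a r <= eps.
  move=> e0; have [||r rn ar] := ha (N eps).
  - exact: leq_addr.
  - by rewrite /N addnS.
  exists r => //; rewrite -(@ler_pXn2r _ 2)// ?nnegrE ?a0 ?(ltW e0)//.
  apply: (le_trans ar).
  have Npos : 0 < (N eps)%:R :> R by rewrite ltr0n /N addnS.
  rewrite ler_pdivrMr ?sqrtr_gt0//.
  have e2 : 0 < eps ^+ 2 by rewrite exprn_gt0.
  rewrite mulrC -ler_pdivrMr//.
  have -> : B / eps ^+ 2 = Num.sqrt ((B / eps ^+ 2) ^+ 2).
    by rewrite sqrtr_sqr ger0_norm// divr_ge0// ltW.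
  rewrite ler_sqrt// expr_div_n -exprM.
  have := truncnS_gt (B ^+ 2 * eps ^- 4); rewrite /N natrD.
  move=> /ltW/le_trans; apply; by rewrite lerDr ler0n.
have ex (eps : R) : exists t : nat, 0 < eps -> first_hit a eps t /\ (t <= (N eps).*2)%N.
  have [e0|] := pselect (0 < eps); last by exists 0%N.
  have [r /andP[r1 rN] ar] := hit _ e0.
  have exP : exists n, (1 <= n)%N && (a n <= eps) by exists r; rewrite r1 ar.
  case: (ex_minnP exP) => t /andP[t1 at_] tmin; exists t => _; split.
    by split => // q q1 aq; apply: tmin; rewrite q1 aq.
  by apply: leq_trans rN; apply: tmin; rewrite r1 ar.
pose T (eps : R) := projT1 (cid (ex eps)).
have TP (eps : R) : 0 < eps -> first_hit a eps (T eps) /\ (T eps <= (N eps).*2)%N.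
  exact: (projT2 (cid (ex eps))).
exists T; split => [eps e0|]; first by have [] := TP _ e0.
exists 0%N; apply/eqO_exP.
exists (2 * (n0%:R + B ^+ 2 + 1)).
  by rewrite mulr_gt0// ltr_wpDl// addr_ge0// sqr_ge0.
have lt1 : \forall e \near (0:R)^'+, e < 1 by apply: nbhs_right_lt.
have gt0 : \forall e \near (0:R)^'+, 0 < e by apply: nbhs_right_gt.
near=> e.
have e0 : 0 < e by near: e.
have e1 : e < 1 by near: e.
rewrite expr0 mulr1 ger0_norm// ger0_norm ?invr_ge0 ?exprn_ge0 ?(ltW e0)//.
have [_ TN] := TP _ e0.
have TN' : (T e)%:R <= 2 * (N e)%:R :> R by rewrite -natrM ler_nat mul2n.
apply: (le_trans TN'); rewrite -mulrA ler_pM2l//.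
have z1 : 1 <= e ^- 4.
  by rewrite invf_ge1 ?exprn_gt0// exprn_ile1// ltW.
rewrite /N addnS -addn1 natrD natrD !mulrDl.
have tr : (Num.truncn (B ^+ 2 * e ^- 4))%:R <= B ^+ 2 * e ^- 4.
  have /truncn_itv/andP[] // : 0 <= B ^+ 2 * e ^- 4.
  by rewrite mulr_ge0 ?sqr_ge0// invr_ge0 exprn_ge0// ltW.
have n0e : n0%:R <= n0%:R * e ^- 4 by rewrite ler_peMr.
by rewrite mul1r; lra.
Unshelve. all: by end_near. Qed.

End averaging.

Theorem theorem2 (R : realType) (K N M : nat)
  (f : 'M[R]_(K.+1, N) * 'rV[R]_M -> R)
  (h : 'I_K.+1 -> 'rV[R]_N -> R) (g : 'rV[R]_M -> R)
  (X : 'I_K.+1 -> set 'rV[R]_N) (Y : set 'rV[R]_M)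
  (U : 'I_K.+1 -> 'rV[R]_N -> 'M[R]_(K.+1, N) -> 'rV[R]_M -> R)
  (l_low : R) (Lx : 'I_K.+1 -> R) (Ly : R) (mu Lu : 'I_K.+1 -> R)
  (rho : R) (gamma beta : nat -> R)
  (x : nat -> 'M[R]_(K.+1, N)) (y : nat -> 'rV[R]_M)
  (hA : assumptionA f h g X Y l_low Lx Ly)
  (hB : assumptionB f X Y U mu Lu)
  (hC2 : assumptionC2 f X Y)
  (rho_gt0 : 0 < rho)
  (hC3 : assumptionC3 rho mu Lx Ly gamma beta)
  (gamma_order : gamma =Theta_\oo (fun r : nat => r%:R `^ (- 4^-1) : R))
  (beta_order : beta =O_\oo (fun r : nat => gamma r ^- 2))
  (hxy : HiBSA f h g X Y U rho gamma beta x y) :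
  exists T : R -> nat,
    (forall eps : R, 0 < eps ->
       first_hit
         (fun r => enorm_pair (stationarity_gap f h g X Y (beta r.+1) rho
                                 (x r.+1) (y r.+1)))
         eps (T eps)) /\
    soft_bigO (0^'+ : set_system R)
      (fun eps => (T eps)%:R) (fun eps => eps ^- 4).
Proof.
set a := (fun r : nat => enorm_pair _).
have a0 r : 0 <= a r by exact: sqrtr_ge0.
have [L0|single] := lipschitz_ge0_or_single hA; last first.
  apply: (@first_hit_rate _ a 1 1) => // n _ n1.
  exists 1%N; first by rewrite /= -addnn (leq_trans n1)// leq_addr.
  by rewrite /a (gap_single hA hxy)// expr0n /= divr_ge0// sqrtr_ge0.
have b0 r : (1 <= r)%N -> 0 < beta r.
  by move=> r1; apply: le_lt_trans (L0 ord0) _; exact: (C3_beta_lipschitz hC3).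
have [c0 [n1 [c00 kap]]] := primal_decrease_ge rho_gt0 (B1_modulus_gt0 hB) hC3
  (fun r r1 => ltW (b0 r r1)).
have [C [n2 [C0 grow]]] := parameter_growth gamma_order beta_order.
have C0' := ltW C0; have rho0 := ltW rho_gt0.
have [D HD] := compact_bounded_dot (A1_compact_Y hA).
have D0 : 0 <= D := le_trans (dot_ge0 _) (HD _ (HiBSA_y1 hxy)).
have gc0 : 0 <= gap_constant Lx Lu.
  by rewrite mulr_ge0// sumr_ge0// => i _; rewrite addr_ge0// sqr_ge0.
pose H := 1 + gamma 1%N * rho / 5.
have H0 : 0 <= H.
  by rewrite addr_ge0// divr_ge0// mulr_ge0// ltW// (C3_gamma_gt0 hC3).
pose k := (2 + gap_constant Lx Lu) / c0.
have k0 : 0 <= k by rewrite divr_ge0 ?addr_ge0// ltW.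
pose d := decrease Ly mu rho gamma beta x y.
pose n0 := maxn 1 (maxn n1 n2).
have dge r : (n0 <= r)%N -> 0 <= d r.
  rewrite !geq_max => /and3P[r1 r2 _]; rewrite /d /decrease addr_ge0//.
    rewrite mulr_ge0 ?dot_ge0//; apply: le_trans (kap _ (leqW r2)).
    by rewrite mulr_ge0 ?addr_ge0// ltW// b0.
  by rewrite mulr_ge0 ?dot_ge0// divr_ge0// mulr_ge0// ltW.
have [|||B B0 HB] := @small_gap_in_window R (fun r => a r.+1 ^+ 2)
    (potential f h g rho gamma x y H D) d (l_low - gamma 1%N / 2 * D)
    (k * (2 * C) + 40 / rho + 2 * D * C) n0.
- rewrite !addr_ge0// ?divr_ge0//; first by apply: mulr_ge0 => //; exact: mulr_ge0.
  by rewrite !mulr_ge0.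
- move=> r nr; split; first exact: dge.
    apply: (potential_descent hA hB hC2) => //.
    by move: nr; rewrite !geq_max => /and3P[].
  apply: (potential_ge hA rho_gt0 hC3 hxy) => //; last by move: nr; rewrite !geq_max => /and3P[].
- move=> r nr; have dr := dge r nr; have dr1 := dge r.+1 (leqW nr).
  move: nr; rewrite !geq_max => /and3P[r1 r2 r3].
  have := gap_sqr_le hA hB rho_gt0 hC3 hxy r1 c00 (b0 _ _) HD (kap _ (leqW r2))
    (ltW (b0 _ _)) (kap _ (leqW (leqW r2))).
  move=> /(_ isT isT); rewrite -/k -/d -/(a r.+1).
  have [_ bg] := grow _ (leqW (leqW r3)); have [gg _] := grow _ (leqW r3).
  set s := Num.sqrt r%:R.
  have s1 : 1 <= s by rewrite -sqrtr1 ler_sqrt// ler1n.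
  have s0 : 0 < s by exact: lt_le_trans s1.
  have s0' := ltW s0.
  have s2 : Num.sqrt r.+2%:R <= 2 * s.
    have -> : 2 = Num.sqrt (2 ^+ 2) :> R by rewrite sqrtr_sqr ger0_norm.
    rewrite -sqrtrM ?sqr_ge0// ler_sqrt ?mulr_gt0 ?exprn_gt0 ?ltr0n//.
    rewrite -natrX -natrM ler_nat.
    apply: (@leq_trans (r + 2 * r)).
      by rewrite -addn2 leq_add2l -[X in (X <= _)%N](muln1 2) leq_mul2l.
    by rewrite -mulSn leq_mul2r orbT.
  have b1 : beta r.+2 + 1 <= 2 * C * s.
    by apply: (le_trans bg); rewrite (mulrC 2) -mulrA; exact: ler_wpM2l.
  have g1 : gamma r.+1 ^+ 2 <= C / s.
    apply: (le_trans gg); apply: ler_wpM2l; first exact: ltW.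
    by rewrite lef_pV2// ?posrE// ?sqrtr_gt0 ?ltr0n// ler_sqrt ?ler_nat// ltr0n.
  exact: (gap_rate_bound s1 k0 (divr_ge0 (ler0n _ _) rho0) D0 C0' dr dr1 b1 g1).
- apply: (first_hit_rate B0 a0 (n0 := n0)) => n nn n1'.
  have [r /andP[rn rn2] ar] := HB n nn n1'.
  exists r.+1; first exact: rn2.
  exact: ar.
Qed.
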